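(* Assume the standing setup below. Let $\rho_r>0$, $\gamma_1>0$, $\rho=\rho_r+\gamma_1$, and suppose conditions (C1), (C2), (C3) hold: (C1) $\|\mathcal{G}_{xm}(s)\|_{\mathcal{L}_1}b_{f,\Omega(\rho_r)}<\rho_r-\|\mathcal{H}_{xv}(s)\|_{\mathcal{L}_1}\|v\|_{\mathcal{L}_\infty}-\rho_\mathrm{in}$; (C2) $\|\mathcal{G}_{xm}(s)\|_{\mathcal{L}_1}L_{f,\Omega(\rho)}<1$; (C3) $\dfrac{\|\mathcal{H}_{xm}(s)\mathcal{C}(s)B^\dagger(sI_n-A_e)\|_{\mathcal{L}_1}}{1-\|\mathcal{G}_{xm}(s)\|_{\mathcal{L}_1}L_{f,\Omega(\rho)}}\gamma_0(T)<\gamma_1$. Suppose further that for each $i\in\{1,\dots,n\}$ a diagonal matrix $\mathrm{T}_x^i$ (with $i$th diagonal entry $1$ and other diagonal entries in $(0,1]$) and a constant $\check\rho_r^i>0$ satisfy $\|\mathrm{T}_x^i\mathcal{G}_{xm}(s)\|_{\mathcal{L}_1}b_{f,\Omega(\rho_r)}<\check\rho_r^i-\|\mathrm{T}_x^i\mathcal{H}_{xv}(s)\|_{\mathcal{L}_1}\|v\|_{\mathcal{L}_\infty}-\check\rho_\mathrm{in}^i$, where $\check\rho_\mathrm{in}^i=\|s\,\mathrm{T}_x^i(sI_n-A_m)^{-1}\|_{\mathcal{L}_1}\max_{x_0\in\mathcal{X}_0}\|x_0\|_\infty$. Let $\mathcal{X}_r\triangleq\{z\in\mathbb{R}^n:|z_i|\le\check\rho_r^i,\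 i=1,\dots,n\}$ and define $\tilde\rho^i\triangleq\|\mathrm{T}_x^i\mathcal{G}_{xm}(s)\|_{\mathcal{L}_1}b_{f,\mathcal{X}_r}+\gamma_1$ ($i=1,\dots,n$), $\rho_{u_a}^j\triangleq\|\mathcal{C}_j(s)\|_{\mathcal{L}_1}b_{f_j,\mathcal{X}_r}+\gamma_2$ and $\tilde\rho_u^j\triangleq\rho_{u_a}^j+\sum_{i=1}^n|K_x[j,i]|\tilde\rho^i$ ($j=1,\dots,m$), where $\gamma_2\triangleq\|\mathcal{C}(s)\|_{\mathcal{L}_1}L_{f,\Omega(\rho)}\gamma_1+\|\mathcal{C}(s)B^\dagger(sI_n-A_e)\|_{\mathcal{L}_1}\gamma_0(T)$. Then for all $t\ge0$: $|x_i(t)-x_{\mathrm{n},i}(t)|\le\tilde\rho^i$ for every $i$; $|u_{a,j}(t)|\le\rho_{u_a}^j$ for every $j$; and $|u_j(t)-u_{\mathrm{n},j}(t)|\le\tilde\rho_u^j$ for every $j$.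
   Context: Notation: $\|\cdot\|_\infty$ vector/induced matrix $\infty$-norm; $\|x\|_{\mathcal{L}_\infty}=\sup_{t\ge0}\|x(t)\|_\infty$; $\Omega(\rho)=\{z:\|z\|_\infty\le\rho\}$; $\mathfrak{L}$ Laplace transform; $B^\dagger$ Moore–Penrose pseudo-inverse; $K_x[j,i]$ is the $(j,i)$ entry; subscript $i$ or $j$ on a vector denotes a component. For a stable proper transfer matrix $\mathcal{H}(s)$, $\|\mathcal{H}(s)\|_{\mathcal{L}_1}=\sup\{\|y\|_{\mathcal{L}_\infty}: y$ the zero-initial-state output for input $u$ with $\|u\|_{\mathcal{L}_\infty}\le1\}$. Standing setup: $A\in\mathbb{R}^{n\times n}$, $B\in\mathbb{R}^{n\times m}$ full column rank, gains $K_x\in\mathbb{R}^{m\times n}$, $K_v\in\mathbb{R}^{m\times m}$ with $A_m=A+BK_x$ Hurwitz, $B_v=BK_v$; $v$ bounded piecewise-continuous; $x_0\in\mathcal{X}_0$, $\mathcal{X}_0$ compact. Uncertainty $f:[0,\infty)\times\mathbb{R}^n\to\mathbb{R}^m$: for every compact $\mathcal{Z}$ there are constants with $|f_j(t,x)-f_j(\tau,z)|\le L_{f_j,\mathcal{Z}}\|x-z\|_\infty+l_{f_j,\mathcal{Z}}|t-\tau|$, $|f_j(t,x)|\le b_{f_j,\mathcal{Z}}$ for $x,z\in\mathcal{Z}$, $t,\tau\ge0$; $L_{f,\mathcal{Z}}=\max_jL_{f_j,\mathcal{Z}}$, $b_{f,\mathcal{Z}}=\max_jb_{f_j,\mathcal{Z}}$.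 Filter $\mathcal{C}(s)=\mathrm{diag}(\mathcal{C}_1(s),\dots,\mathcal{C}_m(s))$, $\mathcal{C}_j(s)=k_f^j/(s+k_f^j)$, $k_f^j>0$. $\mathcal{H}_{xm}=(sI_n-A_m)^{-1}B$, $\mathcal{H}_{xv}=(sI_n-A_m)^{-1}B_v$, $\mathcal{G}_{xm}=\mathcal{H}_{xm}(I_m-\mathcal{C})$, $\rho_\mathrm{in}=\|s(sI_n-A_m)^{-1}\|_{\mathcal{L}_1}\max_{x_0\in\mathcal{X}_0}\|x_0\|_\infty$. Nominal system: $\dot x_\mathrm{n}=A_mx_\mathrm{n}+B_vv$, $x_\mathrm{n}(0)=x_0$, $u_\mathrm{n}=K_xx_\mathrm{n}+K_vv$. Adaptive system: $\dot x=A_mx+B_vv+B(u_a+f(t,x))$, $x(0)=x_0$, total input $u=K_xx+K_vv+u_a$, with $\mathcal{L}_1$ adaptive controller: Hurwitz $A_e$; $B^\perp\in\mathbb{R}^{n\times(n-m)}$ with $(B^\perp)^\top B=0$, $\mathrm{rank}[B\ B^\perp]=n$; predictor $\dot{\hat x}=A_mx+B_vv+B(u_a+\hat\sigma_1)+B^\perp\hat\sigma_2+A_e\tilde x$, $\hat x(0)=x_0$, $\tilde x=\hat x-x$; sample time $T>0$, $\Phi(T)=A_e^{-1}(e^{A_eT}-I_n)$; adaptive law $[\hat\sigma_1(t);\hat\sigma_2(t)]=-[B\ B^\perp]^{-1}\Phi^{-1}(T)e^{A_eT}\tilde x(iT)$ for $t\in[iT,(i+1)T)$, $i\in\mathbb{Z}_+$;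 control law $u_a(s)=-\mathcal{C}(s)\mathfrak{L}[\hat\sigma_1(t)]$. Solutions assumed to exist uniquely on $[0,\infty)$. $\bar\alpha_0(T)=\int_0^T\|e^{A_e(T-\tau)}B\|_\infty d\tau$, $\bar\alpha_1(T)=\max_{t\in[0,T]}\|e^{A_et}\|_\infty$, $\bar\alpha_2(T)=\max_{t\in[0,T]}\int_0^t\|e^{A_e(t-\tau)}\Phi^{-1}(T)e^{A_eT}\|_\infty d\tau$, $\gamma_0(T)=b_{f,\Omega(\rho)}\bar\alpha_0(T)(\bar\alpha_1(T)+\bar\alpha_2(T)+1)$. *)

(* Defs.v *)
From HB Require Import structures.
From mathcomp Require Import all_boot all_order all_algebra.
From mathcomp Require Import all_classical all_reals all_analysis.
From mathcomp Require complex.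
Import complex.ComplexField.
Set Implicit Arguments. Unset Strict Implicit. Unset Printing Implicit Defensive.
Import Order.TTheory GRing.Theory Num.Theory.
Import numFieldNormedType.Exports.
Local Open Scope classical_set_scope.
Local Open Scope ring_scope.

Section Defs.
Variable R : realType.

Definition vnorm {k} (x : 'cV[R]_k) : R := \big[Num.max/0]_(i < k) `|x i 0|.
Definition mnorm {a b} (A : 'M[R]_(a, b)) : R :=
  \big[Num.max/0]_(i < a) \sum_(j < b) `|A i j|.
Definition supnorm {k} (y : R -> 'cV[R]_k) : R :=
  sup [set r | exists2 t, 0 <= t & r = vnorm (y t)].
Definition Rint (a b : R) (g : R -> R) : R :=
  \int[lebesgue_measure]_(s in `[a, b]) g s.
Definition vint {a b} (lo hi : R) (g : R -> 'M[R]_(a, b)) : 'M[R]_(a, b) :=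
  \matrix_(i, j) Rint lo hi (fun s => g s i j).
Definition expmx {k} (A : 'M[R]_k) (t : R) : 'M[R]_k :=
  \matrix_(i, j) limn (fun N => \sum_(q < N) (t ^+ q / (q`!)%:R) * (A ^+ q) i j).
Definition hurwitz {k} (A : 'M[R]_k) : Prop :=
  forall z : complex.complex R,
    root (char_poly (map_mx (fun r : R => complex.Complex r 0) A)) z ->
    complex.Re z < 0.
Definition lti {k a b} (Ar : 'M[R]_k) (Br : 'M[R]_(k, a)) (Cr : 'M[R]_(b, k))
  (Dr : 'M[R]_(b, a)) (u : R -> 'cV[R]_a) : R -> 'cV[R]_b :=
  fun t => Cr *m vint 0 t (fun s => expmx Ar (t - s) *m Br *m u s) + Dr *m u t.
Definition l1norm {a b} (H : (R -> 'cV[R]_a) -> (R -> 'cV[R]_b)) : R :=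
  sup [set r | exists u : R -> 'cV[R]_a,
    [/\ forall i, measurable_fun setT (fun t => u t i 0),
        forall t, 0 <= t -> vnorm (u t) <= 1
      & r = supnorm (H u)]].

(* piecewise continuity on [0, +oo): on every [0, b] there is a finite
   partition such that on each open piece v coincides with a function
   continuous on the closed piece (i.e. v is continuous on the open piece
   and has finite one-sided limits at its ends). *)
Definition pw_continuous {k} (v : R -> 'cV[R]_k) : Prop :=
  forall b, 0 < b -> exists (N : nat) (tau : nat -> R),
    [/\ tau 0%N = 0, tau N = b, (forall q, (q < N)%N -> tau q < tau q.+1)
      & forall q, (q < N)%N -> exists g : R -> 'cV[R]_k,
          (forall i, {within `[tau q, tau q.+1], continuous (fun t => g t i 0)})
          /\ (forall t, tau q < t < tau q.+1 -> v t = g t)].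
Definition bounded_sig {k} (v : R -> 'cV[R]_k) : Prop :=
  exists M, forall t, 0 <= t -> vnorm (v t) <= M.
Definition cont_sig {k} (x : R -> 'cV[R]_k) : Prop :=
  forall i, {within `[0, +oo[, continuous (fun t => x t i 0)}.

Definition is_MP_pinv {a b} (B : 'M[R]_(a, b)) (X : 'M[R]_(b, a)) : Prop :=
  [/\ B *m X *m B = B, X *m B *m X = X,
      (B *m X)^T = B *m X & (X *m B)^T = X *m B].
Definition Omega {k} (rho : R) : set 'cV[R]_k := [set z | vnorm z <= rho].
Definition maxc {k} (c : 'I_k -> R) : R := \big[Num.max/0]_(j < k) c j.

Definition f_consts {k m} (f : R -> 'cV[R]_k -> 'cV[R]_m) (Z : set 'cV[R]_k)
  (j : 'I_m) (L l b : R) : Prop :=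
  forall t tau x z, 0 <= t -> 0 <= tau -> Z x -> Z z ->
    `|f t x j 0 - f tau z j 0| <= L * vnorm (x - z) + l * `|t - tau|
    /\ `|f t x j 0| <= b.
Definition f_standing {k m} (f : R -> 'cV[R]_k -> 'cV[R]_m) : Prop :=
  forall Z : set 'cV[R]_k, compact Z ->
    forall j, exists L l b, f_consts f Z j L l b.

(* ---- transfer matrices, as zero-initial-state input/output operators ---- *)
(* (sI - Am)^{-1} B *)
Definition Hop {k a} (Am : 'M[R]_k) (B : 'M[R]_(k, a)) :=
  lti Am B 1%:M (0 : 'M[R]_(k, a)).
(* Tx s (sI - Am)^{-1} = Tx + Tx Am (sI - Am)^{-1} *)
Definition sResop {k} (Tx Am : 'M[R]_k) := lti Am 1%:M (Tx *m Am) Tx.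
(* C(s) = diag(kf_j / (s + kf_j)) = (sI + K)^{-1} K, K = diag kf *)
Definition Cop {a} (kf : 'rV[R]_a) :=
  lti (- diag_mx kf) (diag_mx kf) 1%:M (0 : 'M[R]_a).
(* C_j(s) = kfj / (s + kfj) (scalar) *)
Definition Cjop (kfj : R) :=
  lti (- (kfj%:M : 'M[R]_1)) (kfj%:M) 1%:M (0 : 'M[R]_1).
Definition Gop {k a} (Am : 'M[R]_k) (B : 'M[R]_(k, a)) (kf : 'rV[R]_a) :=
  fun u => Hop Am B (fun t => u t - Cop kf u t).
(* C(s) B^+ (sI - Ae) = K B^+ - K (sI + K)^{-1} (K B^+ + B^+ Ae) *)
Definition CBAop {k a} (kf : 'rV[R]_a) (Bdag : 'M[R]_(a, k)) (Ae : 'M[R]_k) :=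
  lti (- diag_mx kf) (diag_mx kf *m Bdag + Bdag *m Ae) (- diag_mx kf)
      (diag_mx kf *m Bdag).
Definition premul {a b c} (M : 'M[R]_(c, b))
  (H : (R -> 'cV[R]_a) -> (R -> 'cV[R]_b)) :=
  fun u t => M *m H u t.
Definition compop {a b c} (H1 : (R -> 'cV[R]_b) -> (R -> 'cV[R]_c))
  (H2 : (R -> 'cV[R]_a) -> (R -> 'cV[R]_b)) := fun u => H1 (H2 u).

Definition PhiT {k} (Ae : 'M[R]_k) (T : R) : 'M[R]_k :=
  invmx Ae *m (expmx Ae T - 1%:M).
Definition alpha0 {k a} (Ae : 'M[R]_k) (B : 'M[R]_(k, a)) (T : R) : R :=
  Rint 0 T (fun tau => mnorm (expmx Ae (T - tau) *m B)).
Definition alpha1 {k} (Ae : 'M[R]_k) (T : R) : R :=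
  sup [set r | exists2 t, 0 <= t <= T & r = mnorm (expmx Ae t)].
Definition alpha2 {k} (Ae : 'M[R]_k) (T : R) : R :=
  sup [set r | exists2 t, 0 <= t <= T &
    r = Rint 0 t (fun tau =>
          mnorm (expmx Ae (t - tau) *m invmx (PhiT Ae T) *m expmx Ae T))].
Definition gamma0 {k a} (bf : R) (Ae : 'M[R]_k) (B : 'M[R]_(k, a)) (T : R) : R :=
  bf * alpha0 Ae B T * (alpha1 Ae T + alpha2 Ae T + 1).

End Defs.

(* Main.v *)
Require Import Defs.
From HB Require Import structures.
From mathcomp Require Import all_boot all_order all_algebra.
From mathcomp Require Import all_classical all_reals all_analysis.
From mathcomp Require Import measurable_realfun ring lra.
From mathcomp Require complex.
Import complex.ComplexField.
Import Order.TTheory GRing.Theory Num.Theory.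
Import numFieldNormedType.Exports.
Set Implicit Arguments. Unset Strict Implicit. Unset Printing Implicit Defensive.
Local Open Scope classical_set_scope.
Local Open Scope ring_scope.

(** The reference system of the L1 adaptive control argument never has to be
    solved.  Write [x = xn + G f(.,x) - H C B^+ (s - Ae) xt], where [xt] is the
    prediction error, and compare [x] with the Picard iterates [y_0 = xn],
    [y_(N+1) = xn + G f(.,y_N)].  Condition (C1) and its scaled versions keep every
    iterate in [Omega rho_r] and in [Xr].  On an interval where [x] stays in
    [Omega rho], the sampled adaptive law gives [|xt| <= gamma0], and (C2) turns the
    distance between [x] and [y_N] into an affine contraction whose limit is below
    [gamma1] by (C3); hence some [y_N] and [y_(N+1)] are [gamma1]-close to [x].  This
    gives [|x| < rho] strictly, so by continuity the interval is all of [0, +oo), and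
    then the three bounds by the triangle inequality.

    Every L1 norm is a supremum, so each use of it needs the operator to be bounded:
    if [A] is Hurwitz, Cayley-Hamilton and downward induction on the factors of the
    characteristic polynomial show that [e^(At)] decays exponentially. *)

(** * Functions with a bounded density *)

(** The signals are the obstacle: [v] is only piecewise continuous and the adaptive estimates jump
    at sampling instants, so the equations hold in integral form and trajectories need not be
    differentiable. The calculus is therefore done for functions with a bounded measurable density
    ([prim]). This class is closed under products, which gives integrating factors, variation of
    constants and uniqueness without pointwise derivatives. The operator in front of [xt] comes from
    applying the pseudo-inverse to the error equation: [B^+ B = 1] and [B^+ Bperp = 0] give
    [B^+ (s - Ae) xt = sig1 - f]. Hence the filtered estimate is the filtered uncertainty plus
    [C B^+ (s - Ae) xt], a proper operator because [C] is strictly proper. During the argument [x]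
    is controlled only on an initial interval, whereas an L1 norm speaks of the whole half-line.
    Operators are therefore required to obey one gain bound on every [[0, b]], which makes them
    causal. *)

Section ScalarCalculus.
Context {R : realType}.
Implicit Types (a b c t s : R) (u w h k X Y : R -> R).
Notation mu := (@lebesgue_measure R).
(* [reals.Rint], imported after [Defs], would otherwise shadow the integral. *)
Local Notation Rint := Defs.Rint.

Definition good b u := measurable_fun (`[0, b] : set R) u /\
  exists M, forall t, 0 <= t <= b -> `|u t| <= M.

Lemma good_ext b u w : (forall t, 0 <= t <= b -> u t = w t) ->
  good b u -> good b w.
Proof.
move=> e [mu_ [M hM]]; split; last by exists M => t ht; rewrite -e ?hM.
apply: eq_measurable_fun mu_ => t; rewrite inE/= in_itv/= => ht; exact: e.
Qed.

Lemma goodW b c u : c <= b -> good b u -> good c u.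
Proof.
move=> cb [mu_ [M hM]]; split.
  apply: measurable_funS mu_ => //.
  by apply: subset_itvl; rewrite bnd_simp.
by exists M => t /andP[t0 tc]; apply: hM; rewrite t0 (le_trans tc).
Qed.

Lemma good_cst b c : good b (fun=> c).
Proof. by split => //; exists `|c|. Qed.

Lemma goodD b u w : good b u -> good b w -> good b (fun t => u t + w t).
Proof.
move=> [mu_ [M hM]] [mw [N hN]]; split; first exact: measurable_funD.
exists (M + N) => t ht; apply: le_trans (ler_normD _ _) _.
by rewrite lerD ?hM ?hN.
Qed.

Lemma goodM b u w : good b u -> good b w -> good b (fun t => u t * w t).
Proof.
move=> [mu_ [M hM]] [mw [N hN]]; split; first exact: measurable_funM.
by exists (M * N) => t ht; rewrite normrM ler_pM ?hM ?hN.
Qed.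

Lemma goodN b u : good b u -> good b (fun t => - u t).
Proof.
move=> gu; apply: (good_ext (u := fun t => -1 * u t)) => [t _|].
  by rewrite mulN1r.
by apply: goodM => //; exact: good_cst.
Qed.

Lemma goodB b u w : good b u -> good b w -> good b (fun t => u t - w t).
Proof. by move=> gu gw; apply: goodD => //; exact: goodN. Qed.

Lemma good_norm b u : good b u -> good b (fun t => `|u t|).
Proof.
move=> [mu_ [M hM]]; split; first exact: measurableT_comp.
by exists M => t ht; rewrite normr_id hM.
Qed.

Lemma good_sum b (I : Type) (r : seq I) (P : pred I) (F : I -> R -> R) :
  (forall i, good b (F i)) -> good b (fun t => \sum_(i <- r | P i) F i t).
Proof.
move=> gF; elim: r => [|i r IH].
  by apply: (good_ext (u := fun=> 0)) (good_cst _ _) => t _; rewrite big_nil.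
case: (boolP (P i)) => Pi.
  apply: (good_ext (u := fun t => F i t + \sum_(j <- r | P j) F j t)).
    by move=> t _; rewrite big_cons Pi.
  exact: goodD.
by apply: good_ext IH => t _; rewrite big_cons (negbTE Pi).
Qed.

Lemma good_within_continuous b u : {within `[0, b], continuous u} -> good b u.
Proof.
move=> cu; split; first exact: subspace_continuous_measurable_fun.
have /compact_bounded[M [_ hM]] := continuous_compact cu (@segment_compact R 0 b).
exists (`|M| + 1) => t ht; apply: (hM (`|M| + 1)).
  by rewrite (le_lt_trans (ler_norm M)) // ltrDl.
by exists t => //=; rewrite in_itv.
Qed.

Lemma good_continuous b u : continuous u -> good b u.
Proof. by move=> cu; apply/good_within_continuous/continuous_subspaceT. Qed.

Let measurable_itvR (s t : R) : @measurable _ (measurableTypeR R) `[s, t].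
Proof. exact: measurable_itv. Qed.

Lemma good_integrable b s t u : good b u -> 0 <= s -> t <= b ->
  mu.-integrable `[s, t] (EFin \o u).
Proof.
move=> [mu_ [M hM]] s0 tb.
apply: (measurable_bounded_integrable (measurable_itvR s t)).
- have h : (mu `[s, t] < +oo)%E.
    by rewrite lebesgue_measure_itv/=; case: ifPn => // _; rewrite -EFinB ltry.
  exact: h.
- apply: measurable_funS mu_ => // r /=; rewrite !in_itv/= => /andP[sr rt].
  by rewrite (le_trans s0) // (le_trans rt).
- exists M; split; rewrite ?num_real // => N MN r /=; rewrite in_itv/= => /andP[sr rt].
  by rewrite (le_trans _ (ltW MN)) // hM // (le_trans s0) // (le_trans rt).
Qed.

Lemma Rint_ext s t u w : (forall r, s <= r <= t -> u r = w r) ->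
  Rint s t u = Rint s t w.
Proof.
by move=> e; apply: eq_Rintegral => r; rewrite inE/= in_itv/=; exact: e.
Qed.

Lemma Rint_point s u : Rint s s u = 0.
Proof. by rewrite /Rint set_itv1 Rintegral_set1. Qed.

Lemma Rint_cst s t c : s <= t -> Rint s t (fun=> c) = c * (t - s).
Proof.
move=> st; rewrite /Rint Rintegral_cst; last exact: measurable_itvR.
congr (_ * _).
transitivity (fine (if (s%:E < t%:E)%E then t%:E - s%:E else 0)%E).
  by congr fine; exact: lebesgue_measure_itv.
by rewrite lte_fin; case: ltgtP st => //= -> _; rewrite subrr.
Qed.

Lemma Rint0 s t : Rint s t (fun=> 0) = 0.
Proof.
have [st|ts] := leP s t; first by rewrite Rint_cst// mul0r.
by rewrite /Rint set_itv_ge ?Rintegral_set0 // bnd_simp -ltNge.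
Qed.

Section OnGood.
Variable b : R.
Variables s t : R.
Hypotheses (s0 : 0 <= s) (tb : t <= b).

Lemma RintD u w : good b u -> good b w ->
  Rint s t (fun r => u r + w r) = Rint s t u + Rint s t w.
Proof.
move=> gu gw; apply: RintegralD; first exact: measurable_itvR.
  exact: good_integrable gu s0 tb.
exact: good_integrable gw s0 tb.
Qed.

Lemma RintZ c u : good b u -> Rint s t (fun r => c * u r) = c * Rint s t u.
Proof.
move=> gu; apply: RintegralZl; first exact: measurable_itvR.
exact: good_integrable gu s0 tb.
Qed.

Lemma RintN u : good b u -> Rint s t (fun r => - u r) = - Rint s t u.
Proof.
move=> gu; rewrite -mulN1r -RintZ//; apply: Rint_ext => r _.
by rewrite mulN1r.
Qed.

Lemma RintB u w : good b u -> good b w ->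
  Rint s t (fun r => u r - w r) = Rint s t u - Rint s t w.
Proof. by move=> gu gw; rewrite RintD ?RintN//; exact: goodN. Qed.

Lemma Rint_sum (I : Type) (r : seq I) (P : pred I) (F : I -> R -> R) :
  (forall i, good b (F i)) ->
  Rint s t (fun x => \sum_(i <- r | P i) F i x) = \sum_(i <- r | P i) Rint s t (F i).
Proof.
move=> gF; elim: r => [|i r IH].
  rewrite big_nil -[RHS](Rint0 s t); apply: Rint_ext => x _; exact: big_nil.
rewrite big_cons; case: ifPn => Pi; last first.
  by rewrite -IH; apply: Rint_ext => x _; rewrite big_cons (negbTE Pi).
rewrite -IH -RintD//; last exact: good_sum.
by apply: Rint_ext => x _; rewrite big_cons Pi.
Qed.

Lemma Rint_le u w : good b u -> good b w ->
  (forall r, s <= r <= t -> u r <= w r) -> Rint s t u <= Rint s t w.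
Proof.
move=> gu gw uw; apply: le_Rintegral.
- exact: measurable_itvR.
- exact: good_integrable gu s0 tb.
- exact: good_integrable gw s0 tb.
- by move=> r /=; rewrite in_itv/=; exact: uw.
Qed.

Lemma Rint_norm u : good b u -> `|Rint s t u| <= Rint s t (fun r => `|u r|).
Proof.
move=> gu; apply: le_normr_Rintegral; first exact: measurable_itvR.
exact: good_integrable gu s0 tb.
Qed.

Lemma Rint_norm_le M u : s <= t -> good b u ->
  (forall r, s <= r <= t -> `|u r| <= M) -> `|Rint s t u| <= M * (t - s).
Proof.
move=> st gu uM; apply: le_trans (Rint_norm gu) _.
rewrite -Rint_cst//; apply: Rint_le => //; first exact: good_norm.
exact: good_cst.
Qed.

Lemma Rint_cat r u : s <= r <= t -> good b u ->
  Rint s t u = Rint s r u + Rint r t u.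
Proof.
move=> /andP[sr rt] gu; have iu := good_integrable gu s0 tb.
have e : Rint s t u - Rint s r u = \int[mu]_(x in `]r, t]) u x.
  by apply: Rintegral_itvB => //; rewrite bnd_simp.
rewrite -[LHS](subrKC (Rint s r u)) e; congr (_ + _).
apply: Rintegral_itv_obnd_cbnd.
by apply: integrableS iu => //; apply: subset_itv; rewrite bnd_simp.
Qed.

End OnGood.

Lemma Rint_ge0 s t u : (forall r, s <= r <= t -> 0 <= u r) -> 0 <= Rint s t u.
Proof.
by move=> u0; apply: Rintegral_ge0 => r /=; rewrite in_itv/=; exact: u0.
Qed.

(* X is absolutely continuous on [0, b] with the bounded density h. *)
Definition prim b X h := good b h /\
  forall t, 0 <= t <= b -> X t = X 0 + Rint 0 t h.

Lemma prim_ext b X Y h k : (forall t, 0 <= t <= b -> X t = Y t) ->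
  (forall t, 0 <= t <= b -> h t = k t) -> prim b X h -> prim b Y k.
Proof.
move=> eX eh [gh hX]; split; first exact: good_ext gh.
move=> t /andP[t0 tb]; rewrite -eX ?t0// -[Y 0]eX ?lexx ?(le_trans t0)//.
rewrite hX ?t0//.
congr (_ + _); apply: Rint_ext => r /andP[r0 rt]; apply: eh.
by rewrite r0 (le_trans rt).
Qed.

Lemma prim_incr b X h s t : prim b X h -> 0 <= s -> s <= t -> t <= b ->
  X t - X s = Rint s t h.
Proof.
move=> [gh hX] s0 st tb; have t0 := le_trans s0 st; have sb := le_trans st tb.
rewrite (hX t) ?t0// (hX s) ?s0//.
by rewrite (@Rint_cat b 0 t _ _ s) ?s0//; ring.
Qed.

Lemma prim_lip b X h : prim b X h ->
  exists2 M, 0 <= M & forall s t, 0 <= s -> s <= t -> t <= b ->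
    `|X t - X s| <= M * (t - s).
Proof.
move=> pX; have [[_ [M hM]] _] := pX; exists `|M| => // s t s0 st tb.
rewrite (prim_incr pX)//; apply: (Rint_norm_le s0 tb) => //.
  by case: pX.
move=> r /andP[sr rt]; apply: le_trans (ler_norm M).
by rewrite hM// (le_trans s0)// (le_trans rt).
Qed.

Lemma lip_within_continuous b X M :
  (forall s t, 0 <= s -> s <= t -> t <= b -> `|X t - X s| <= M * (t - s)) ->
  {within `[0, b], continuous X}.
Proof.
move=> lX; have lX' s t : 0 <= s <= b -> 0 <= t <= b ->
    `|X t - X s| <= M * `|t - s|.
  move=> /andP[s0 sb] /andP[t0 tb]; have [st|/ltW ts] := leP s t.
    by rewrite (ger0_norm (x := t - s)) ?subr_ge0// lX.
  by rewrite distrC (distrC t) (ger0_norm (x := s - t)) ?subr_ge0// lX.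
apply/subspace_continuousP => s /=; rewrite in_itv/= => hs.
apply/(@cvgrPdist_le _ R^o) => e e0.
have M1 : 0 < `|M| + 1 by rewrite ltr_pwDr.
rewrite near_withinE; near=> t => /=; rewrite in_itv/= => ht.
apply: le_trans (lX' t s ht hs) _.
apply: (@le_trans _ _ ((`|M| + 1) * `|s - t|)).
  by rewrite ler_wpM2r// (le_trans (ler_norm M))// lerDl.
rewrite mulrC -ler_pdivlMr//; near: t.
by apply: (@cvgr_dist_le _ R^o _ _ _ id s cvg_id); rewrite divr_gt0.
Unshelve. all: end_near. Qed.

Lemma prim_continuous b X h : prim b X h -> {within `[0, b], continuous X}.
Proof. by move=> /prim_lip[M _ /lip_within_continuous]. Qed.

Lemma prim_good b X h : prim b X h -> good b X.
Proof. by move=> /prim_continuous/good_within_continuous. Qed.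

Lemma prim_int b h a : good b h -> prim b (fun t => a + Rint 0 t h) h.
Proof. by move=> gh; split=> // t _; rewrite Rint_point addr0. Qed.

Lemma prim_cst b c : prim b (fun=> c) (fun=> 0).
Proof. by split; [exact: good_cst|move=> t _; rewrite Rint0 addr0]. Qed.

Lemma primD b X Y h k : prim b X h -> prim b Y k ->
  prim b (fun t => X t + Y t) (fun t => h t + k t).
Proof.
move=> [gh hX] [gk hY]; split; first exact: goodD.
by move=> t /andP[t0 tb]; rewrite (hX t) ?t0// (hY t) ?t0// (RintD (b := b))//; ring.
Qed.

Lemma prim_sum b (I : Type) (r : seq I) (P : pred I) (F G : I -> R -> R) :
  (forall i, prim b (F i) (G i)) ->
  prim b (fun t => \sum_(i <- r | P i) F i t) (fun t => \sum_(i <- r | P i) G i t).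
Proof.
move=> pF; split; first by apply: good_sum => i; case: (pF i).
move=> t /andP[t0 tb]; rewrite (Rint_sum (b := b))//; last by move=> i; case: (pF i).
rewrite -big_split/=; apply: eq_bigr => i _.
by case: (pF i) => _ ->//; rewrite t0.
Qed.

(** Over [N + 1] equal steps the increment of [X] telescopes into terms of size [K (b / (N + 1))^2],
    whose sum [K b^2 / (N + 1)] tends to zero. *)
Lemma quadratic_increments_const b X K : 0 <= b ->
  (forall s t, 0 <= s -> s <= t -> t <= b -> `|X t - X s| <= K * (t - s) ^+ 2) ->
  X b = X 0.
Proof.
move=> b0 hK; apply/eqP; rewrite -subr_eq0 -normr_le0; apply/ler_addgt0Pr => e e0.
rewrite add0r.
have bound N : `|X b - X 0| <= K * b ^+ 2 / N.+1%:R.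
  have -> : X b - X 0 = \sum_(0 <= i < N.+1)
      (X (b * i.+1%:R / N.+1%:R) - X (b * i%:R / N.+1%:R)).
    rewrite (telescope_sumr (fun i => X (b * i%:R / N.+1%:R)))//.
    by rewrite mulfK// mulr0 mul0r.
  apply: le_trans (ler_norm_sum _ _ _) _.
  apply: (@le_trans _ _ (\sum_(0 <= i < N.+1) K * (b / N.+1%:R) ^+ 2)).
    rewrite !big_nat; apply: ler_sum => i /andP[_ iN].
    have -> : b / N.+1%:R = b * i.+1%:R / N.+1%:R - b * i%:R / N.+1%:R.
      by rewrite -mulrBl -mulrBr -natrB// subSnn mulr1.
    apply: hK.
    - by rewrite divr_ge0// mulr_ge0.
    - by rewrite ler_wpM2r// ler_wpM2l// ler_nat.
    - by rewrite ler_pdivrMr// ler_wpM2l// ler_nat.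
  rewrite sumr_const_nat subn0 -mulr_natr.
  have N0 : N.+1%:R != 0 :> R by [].
  by rewrite le_eqVlt; apply/orP; left; apply/eqP; field.
pose N := Num.truncn (K * b ^+ 2 / e).
apply: le_trans (bound N) _.
by rewrite ler_pdivrMr// -ler_pdivrMl// mulrC ltW// truncnS_gt.
Qed.

(* h and k need not be continuous: the increments of the defect of the product
   rule are quadratic in the step, which forces it to be constant. *)
Lemma primM b X Y h k : prim b X h -> prim b Y k ->
  prim b (fun t => X t * Y t) (fun t => h t * Y t + X t * k t).
Proof.
move=> pX pY; have [gh _] := pX; have [gk _] := pY.
have gX := prim_good pX; have gY := prim_good pY.
have gd : good b (fun t => h t * Y t + X t * k t) by apply: goodD; apply: goodM.
split=> // t /andP[t0 tb].
pose Z r := X r * Y r - Rint 0 r (fun r => h r * Y r + X r * k r).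
suff : Z t = Z 0 by rewrite /Z Rint_point subr0 => <-; rewrite subrK.
have [LX LX0 lX] := prim_lip pX; have [LY LY0 lY] := prim_lip pY.
have [_ [Mh hMh]] := gh; have [_ [Mk hMk]] := gk.
have Mh0 : 0 <= Mh by apply: le_trans (hMh t _); rewrite ?t0.
have Mk0 : 0 <= Mk by apply: le_trans (hMk t _); rewrite ?t0.
apply: (@quadratic_increments_const _ _ (Mh * LY + LX * Mk)) => // s r s0 sr rt.
have rb := le_trans rt tb.
have g1 : good b (fun q => h q * (Y r - Y q)).
  by apply: goodM => //; apply: goodB => //; exact: good_cst.
have g2 : good b (fun q => (X s - X q) * k q).
  by apply: goodM => //; apply: goodB => //; exact: good_cst.
(* With [Y] frozen at the right end and [X] at the left end, the product increment is exactly
   [Y r (X r - X s) + X s (Y r - Y s)]. The factors left in the integral are Lipschitz increments,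
   so the integral is quadratic in [r - s]. *)
have -> : Z r - Z s = Rint s r (fun q => h q * (Y r - Y q) + (X s - X q) * k q).
  have -> : Rint s r (fun q => h q * (Y r - Y q) + (X s - X q) * k q) =
     Rint s r (fun q => (Y r * h q + X s * k q) - (h q * Y q + X q * k q)).
    by apply: Rint_ext => q _; ring.
  rewrite (RintB (b := b))//; last first.
    by apply: goodD; apply: goodM => //; exact: good_cst.
  rewrite (RintD (b := b))//; try by apply: goodM => //; exact: good_cst.
  rewrite !(RintZ (b := b))// -(prim_incr pX)// -(prim_incr pY)//.
  by rewrite /Z (@Rint_cat b 0 r _ _ s) ?s0//; ring.
have -> : (Mh * LY + LX * Mk) * (r - s) ^+ 2 =
  (Mh * (LY * (r - s)) + (LX * (r - s)) * Mk) * (r - s) by ring.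
apply: (Rint_norm_le s0 rb) => //; first exact: goodD.
move=> q /andP[sq qr]; apply: le_trans (ler_normD _ _) _; rewrite !normrM.
have q0 := le_trans s0 sq.
have qb := le_trans qr rb.
apply: lerD; apply: ler_pM => //.
- by rewrite hMh// q0.
- by apply: le_trans (lY _ _ _ _ _) _ => //; rewrite ler_wpM2l// lerB.
- by rewrite distrC; apply: le_trans (lX _ _ _ _ _) _ => //; rewrite ler_wpM2l// lerB.
- by rewrite hMk// q0.
Qed.

Lemma primZ b c X h : prim b X h -> prim b (fun t => c * X t) (fun t => c * h t).
Proof.
move=> pX; apply: prim_ext (primM (prim_cst b c) pX) => t _ //.
by rewrite mul0r add0r.
Qed.

Lemma primN b X h : prim b X h -> prim b (fun t => - X t) (fun t => - h t).
Proof. by move=> /(primZ (-1)); apply: prim_ext => t _; rewrite mulN1r. Qed.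

Lemma prim_derive b X h : (forall t, is_derive t (1 : R) X (h t)) ->
  continuous h -> prim b X h.
Proof.
move=> dX ch; split; first exact: good_continuous.
have cX : continuous X.
  by move=> t; apply/differentiable_continuous/derivable1_diffP; case: (dX t).
move=> t /andP[]; rewrite le_eqVlt => /predU1P[<- _|t0 tb].
  by rewrite Rint_point addr0.
rewrite /Rint /Rintegral (@continuous_FTC2 _ _ X) //=; first by rewrite subrKC.
- exact: continuous_subspaceT.
- split => [r _||]; first by case: (dX r).
  + apply: cvg_at_right_filter; exact: cX.
  + apply: cvg_at_left_filter; exact: cX.
- by move=> r _; rewrite derive1E; case: (dX r).
Qed.

End ScalarCalculus.

(** * Matrix-valued functions and the matrix exponential *)

Section MatrixCalculus.
Context {R : realType}.
Implicit Types (b s t : R).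
Local Notation Rint := Defs.Rint.

Definition mgood b {p q} (U : R -> 'M[R]_(p, q)) :=
  forall i j, good b (fun t => U t i j).

Definition mprim b {p q} (X H : R -> 'M[R]_(p, q)) :=
  forall i j, prim b (fun t => X t i j) (fun t => H t i j).

Lemma mgood_ext b p q (U W : R -> 'M[R]_(p, q)) :
  (forall t, 0 <= t <= b -> U t = W t) -> mgood b U -> mgood b W.
Proof. by move=> e gU i j; apply: good_ext (gU i j) => t ht; rewrite e. Qed.

Lemma mgood_cst b p q (C : 'M[R]_(p, q)) : mgood b (fun=> C).
Proof. by move=> i j; exact: good_cst. Qed.

Lemma mgoodW b c p q (U : R -> 'M[R]_(p, q)) : c <= b -> mgood b U -> mgood c U.
Proof. by move=> cb gU i j; exact: goodW (gU i j). Qed.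

Lemma mgoodD b p q (U W : R -> 'M[R]_(p, q)) :
  mgood b U -> mgood b W -> mgood b (fun t => U t + W t).
Proof.
move=> gU gW i j; apply: good_ext (goodD (gU i j) (gW i j)) => t _.
by rewrite mxE.
Qed.

Lemma mgoodM b p q r (U : R -> 'M[R]_(p, q)) (W : R -> 'M[R]_(q, r)) :
  mgood b U -> mgood b W -> mgood b (fun t => U t *m W t).
Proof.
move=> gU gW i j.
apply: (good_ext (u := fun t => \sum_k U t i k * W t k j)).
  by move=> t _; rewrite mxE.
by apply: good_sum => k; exact: goodM.
Qed.

Lemma mgoodMl b p q r (C : 'M[R]_(p, q)) (W : R -> 'M[R]_(q, r)) :
  mgood b W -> mgood b (fun t => C *m W t).
Proof. by move=> gW; apply: mgoodM => //; exact: mgood_cst. Qed.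

Lemma mgoodN b p q (U : R -> 'M[R]_(p, q)) :
  mgood b U -> mgood b (fun t => - U t).
Proof. by move=> gU i j; apply: good_ext (goodN (gU i j)) => t _; rewrite mxE. Qed.

Lemma mgoodB b p q (U W : R -> 'M[R]_(p, q)) :
  mgood b U -> mgood b W -> mgood b (fun t => U t - W t).
Proof. by move=> gU /mgoodN; exact: mgoodD. Qed.

Lemma mgoodZ b p q c (U : R -> 'M[R]_(p, q)) :
  mgood b U -> mgood b (fun t => c *: U t).
Proof.
move=> gU i j; apply: good_ext (goodM (good_cst b c) (gU i j)) => t _.
by rewrite mxE.
Qed.

Lemma mprim_ext b p q (X Y H K : R -> 'M[R]_(p, q)) :
  (forall t, 0 <= t <= b -> X t = Y t) -> (forall t, 0 <= t <= b -> H t = K t) ->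
  mprim b X H -> mprim b Y K.
Proof.
by move=> eX eH pX i j; apply: prim_ext (pX i j) => t ht; rewrite ?eX ?eH.
Qed.

Lemma mprim_good b p q (X H : R -> 'M[R]_(p, q)) : mprim b X H -> mgood b X.
Proof. by move=> pX i j; exact: prim_good (pX i j). Qed.

Lemma mprim_cst b p q (C : 'M[R]_(p, q)) : mprim b (fun=> C) (fun=> 0).
Proof. by move=> i j; apply: prim_ext (prim_cst b (C i j)) => t _; rewrite ?mxE. Qed.

Lemma mprimD b p q (X Y H K : R -> 'M[R]_(p, q)) :
  mprim b X H -> mprim b Y K ->
  mprim b (fun t => X t + Y t) (fun t => H t + K t).
Proof.
by move=> pX pY i j; apply: prim_ext (primD (pX i j) (pY i j)) => t _; rewrite !mxE.
Qed.

Lemma mprimM b p q r (X H : R -> 'M[R]_(p, q)) (Y K : R -> 'M[R]_(q, r)) :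
  mprim b X H -> mprim b Y K ->
  mprim b (fun t => X t *m Y t) (fun t => H t *m Y t + X t *m K t).
Proof.
move=> pX pY i j.
apply: prim_ext (prim_sum (index_enum 'I_q) xpredT
  (fun k => primM (pX i k) (pY k j))) => t _; rewrite !mxE//.
exact: big_split.
Qed.

Lemma mprimMl b p q r (C : 'M[R]_(p, q)) (Y K : R -> 'M[R]_(q, r)) :
  mprim b Y K -> mprim b (fun t => C *m Y t) (fun t => C *m K t).
Proof.
move=> pY; apply: mprim_ext (mprimM (mprim_cst b C) pY) => t _ //.
by rewrite mul0mx add0r.
Qed.

Lemma mprimN b p q (X H : R -> 'M[R]_(p, q)) :
  mprim b X H -> mprim b (fun t => - X t) (fun t => - H t).
Proof.
by move=> pX i j; apply: prim_ext (primN (pX i j)) => t _; rewrite mxE.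
Qed.

Lemma mprimB b p q (X Y H K : R -> 'M[R]_(p, q)) :
  mprim b X H -> mprim b Y K ->
  mprim b (fun t => X t - Y t) (fun t => H t - K t).
Proof. by move=> pX /mprimN; exact: mprimD. Qed.

Lemma vint_ext p q s t (U W : R -> 'M[R]_(p, q)) :
  (forall r, s <= r <= t -> U r = W r) -> vint s t U = vint s t W.
Proof.
move=> e; apply/matrixP => i j; rewrite !mxE; apply: Rint_ext => r hr.
by rewrite e.
Qed.

Lemma vint_point p q s (U : R -> 'M[R]_(p, q)) : vint s s U = 0.
Proof. by apply/matrixP => i j; rewrite !mxE Rint_point. Qed.

Lemma vint0 p q s t : vint s t (fun=> 0) = 0 :> 'M[R]_(p, q).
Proof.
by apply/matrixP => i j; rewrite !mxE Rint0.
Qed.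

Lemma vint_cat b p q s t r (U : R -> 'M[R]_(p, q)) : 0 <= s -> t <= b ->
  s <= r <= t -> mgood b U -> vint s t U = vint s r U + vint r t U.
Proof.
move=> s0 tb srt gU; apply/matrixP => i j; rewrite !mxE.
exact: (@Rint_cat _ b).
Qed.

Lemma vintD b p q s t (U W : R -> 'M[R]_(p, q)) : 0 <= s -> t <= b ->
  mgood b U -> mgood b W ->
  vint s t (fun r => U r + W r) = vint s t U + vint s t W.
Proof.
move=> s0 tb gU gW; apply/matrixP => i j; rewrite !mxE -(@RintD _ b)//.
by apply: Rint_ext => r _; rewrite mxE.
Qed.

Lemma vintZ b p q s t c (U : R -> 'M[R]_(p, q)) : 0 <= s -> t <= b ->
  mgood b U -> vint s t (fun r => c *: U r) = c *: vint s t U.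
Proof.
move=> s0 tb gU; apply/matrixP => i j; rewrite !mxE -(@RintZ _ b)//.
by apply: Rint_ext => r _; rewrite mxE.
Qed.

Lemma vintN b p q s t (U : R -> 'M[R]_(p, q)) : 0 <= s -> t <= b ->
  mgood b U -> vint s t (fun r => - U r) = - vint s t U.
Proof.
move=> s0 tb gU; rewrite -scaleN1r -(@vintZ b)//.
by apply: vint_ext => r _; rewrite scaleN1r.
Qed.

Lemma vintMl b p q r s t (C : 'M[R]_(p, q)) (U : R -> 'M[R]_(q, r)) :
  0 <= s -> t <= b -> mgood b U ->
  vint s t (fun r => C *m U r) = C *m vint s t U.
Proof.
move=> s0 tb gU; apply/matrixP => i j; rewrite !mxE.
under [RHS]eq_bigr do rewrite mxE -(@RintZ _ b)//.
rewrite -(@Rint_sum _ b)//; last by move=> k; apply: goodM => //; exact: good_cst.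
by apply: Rint_ext => x _; rewrite mxE.
Qed.

Lemma vintMr b p q r s t (U : R -> 'M[R]_(p, q)) (C : 'M[R]_(q, r)) :
  0 <= s -> t <= b -> mgood b U ->
  vint s t (fun r => U r *m C) = vint s t U *m C.
Proof.
move=> s0 tb gU; apply/matrixP => i j; rewrite !mxE.
under [RHS]eq_bigr do rewrite mxE mulrC -(@RintZ _ b)//.
rewrite -(@Rint_sum _ b)//; last by move=> k; apply: goodM => //; exact: good_cst.
by apply: Rint_ext => x _; rewrite mxE; apply: eq_bigr => k _; rewrite mulrC.
Qed.

Lemma mprimE b p q (X H : R -> 'M[R]_(p, q)) t : mprim b X H -> 0 <= t <= b ->
  X t = X 0 + vint 0 t H.
Proof. by move=> pX ht; apply/matrixP => i j; rewrite !mxE; case: (pX i j) => _ ->. Qed.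

Lemma mprim_incr b p q (X H : R -> 'M[R]_(p, q)) s t : mprim b X H ->
  0 <= s -> s <= t -> t <= b -> X t - X s = vint s t H.
Proof.
move=> pX s0 st tb; apply/matrixP => i j.
by rewrite [RHS]mxE -(prim_incr (pX i j))// !mxE.
Qed.

Lemma mprim_vint b p q C (X H : R -> 'M[R]_(p, q)) : mgood b H ->
  (forall t, 0 <= t <= b -> X t = C + vint 0 t H) -> mprim b X H.
Proof.
move=> gH eX i j; apply: prim_ext (prim_int (C i j) (gH i j)) => t ht //.
by rewrite eX// !mxE.
Qed.

Lemma mprim_const b p q (X H : R -> 'M[R]_(p, q)) t : mprim b X H ->
  (forall s, 0 <= s <= b -> H s = 0) -> 0 <= t <= b -> X t = X 0.
Proof.
move=> pX H0 /andP[t0 tb]; rewrite (mprimE (t := t) pX) ?t0//.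
rewrite (@vint_ext _ _ _ _ _ (fun=> 0)) ?vint0 ?addr0// => r /andP[r0 rt].
by rewrite H0// r0 (le_trans rt).
Qed.

End MatrixCalculus.

(** * The matrix exponential: convergence, derivative, semigroup law *)

Section MatrixExponential.
Context {R : realType} {k : nat}.
Implicit Types (A : 'M[R]_k) (t : R).

(** The entrywise l1 norm dominates every entry, and its powers dominate the entries of the powers
    of [A]; this compares the series with a scalar exponential. *)
Let absum A := \sum_(i < k) \sum_(j < k) `|A i j|.

Let ler_absum_exp A q i j : `|(A ^+ q) i j| <= absum A ^+ q.
Proof.
have A0 : 0 <= absum A by rewrite sumr_ge0// => *; rewrite sumr_ge0.
elim: q i j => [|q IH] i j.
  by rewrite !expr0 mxE; case: (_ == _); rewrite ?normr1 ?normr0 ?ler01.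
rewrite !exprS mxE; apply: le_trans (ler_norm_sum _ _ _) _.
apply: (@le_trans _ _ (\sum_l `|A i l| * absum A ^+ q)).
  by apply: ler_sum => l _; rewrite normrM ler_wpM2l.
rewrite -mulr_suml ler_wpM2r ?exprn_ge0// /absum [leRHS](bigD1 i)//= lerDl.
by rewrite sumr_ge0// => *; rewrite sumr_ge0.
Qed.

(** The prefix [M] closes the family under formal differentiation, which replaces [M] by [M *m A];
    one convergence proof then covers the series and all its derivatives. *)
Let coef A (M : 'M[R]_k) i j : R ^nat := fun q => (M *m A ^+ q) i j / q`!%:R.

Let coef_bound A M i j q : `|coef A M i j q| <= absum M * (absum A ^+ q / q`!%:R).
Proof.
have A0 B : 0 <= absum B by rewrite sumr_ge0// => *; rewrite sumr_ge0.
rewrite /coef normrM mulrA [X in _ * X]ger0_norm ?invr_ge0// ler_wpM2r ?invr_ge0//.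
rewrite mxE; apply: le_trans (ler_norm_sum _ _ _) _.
apply: (@le_trans _ _ (\sum_l `|M i l| * absum A ^+ q)).
  by apply: ler_sum => l _; rewrite normrM ler_wpM2l// ler_absum_exp.
rewrite -mulr_suml ler_wpM2r ?exprn_ge0// /absum [leRHS](bigD1 i)//= lerDl.
by rewrite sumr_ge0// => *; rewrite sumr_ge0.
Qed.

Let is_cvg_coef A M i j t : cvgn (pseries (coef A M i j) t).
Proof.
have A0 B : 0 <= absum B by rewrite sumr_ge0// => *; rewrite sumr_ge0.
apply: normed_cvg.
apply: (@series_le_cvg _ _ (fun q => absum M * exp_coeff (absum A * `|t|) q)) => //.
- by move=> q /=.
- by move=> q /=; rewrite mulr_ge0// exp_coeff_ge0// mulr_ge0.
- move=> q; rewrite /= normrM /exp_coeff/= exprMn.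
  rewrite [leRHS](_ : _ = absum M * (absum A ^+ q / q`!%:R) * `|t ^+ q|).
    by rewrite ler_wpM2r.
  by rewrite normrX; ring.
- rewrite (_ : series _ = (fun n => absum M * series (exp_coeff (absum A * `|t|)) n)).
    by apply: is_cvgMr; exact: is_cvg_series_exp_coeff.
  by apply/funext => n; rewrite /series/= mulr_sumr.
Qed.

Let partial A t N : 'M[R]_k := \sum_(q < N) (t ^+ q / q`!%:R) *: A ^+ q.

Let partial_coef A M i j t N :
  (M *m partial A t N) i j = pseries (coef A M i j) t N.
Proof.
rewrite /partial mulmx_sumr summxE /pseries /series/= big_mkord.
by apply: eq_bigr => q _; rewrite -scalemxAr mxE /coef; ring.
Qed.

Let expmx_partial A t i j : partial A t N i j @[N --> \oo] --> expmx A t i j.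
Proof.
have e : (fun N => partial A t N i j) = pseries (coef A 1%:M i j) t.
  by apply/funext => N; rewrite -partial_coef mul1mx.
rewrite /expmx mxE.
have -> : (fun N : nat => \sum_(q < N) t ^+ q / q`!%:R * (A ^+ q) i j) =
          (fun N => partial A t N i j).
  by apply/funext => N; rewrite summxE; apply: eq_bigr => q _; rewrite mxE.
by rewrite e; exact: is_cvg_coef.
Qed.

Let cvg_partialMl A (M : 'M[R]_k) t i j :
  (M *m partial A t N) i j @[N --> \oo] --> (M *m expmx A t) i j.
Proof.
rewrite [X in _ --> X]mxE.
rewrite (_ : (fun N => _) = (fun N => \sum_l M i l * partial A t N l j)); last first.
  by apply/funext => N; rewrite mxE.
apply: cvg_big => [|l _]; first exact: add_continuous.
by apply: cvgMr; exact: expmx_partial.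
Qed.

Let cvg_partialMr A (M : 'M[R]_k) t i j :
  (partial A t N *m M) i j @[N --> \oo] --> (expmx A t *m M) i j.
Proof.
rewrite [X in _ --> X]mxE.
rewrite (_ : (fun N => _) = (fun N => \sum_l partial A t N i l * M l j)); last first.
  by apply/funext => N; rewrite mxE.
apply: cvg_big => [|l _]; first exact: add_continuous.
by apply: cvgMl; exact: expmx_partial.
Qed.

Lemma expmx_comm A t : A *m expmx A t = expmx A t *m A.
Proof.
apply/matrixP => i j.
apply: (@cvg_unique _ (@Rhausdorff R) _ _ _ _ (@cvg_partialMl A A t i j)).
rewrite (_ : (fun N => _) = (fun N => (partial A t N *m A) i j)); last first.
  apply/funext => N; congr (fun_of_matrix _ i j).
  rewrite mulmx_sumr mulmx_suml; apply: eq_bigr => q _.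
  by rewrite -scalemxAr -scalemxAl !mulmxE -exprS exprSr.
exact: cvg_partialMr.
Qed.

Lemma expmx0 A : expmx A 0 = 1%:M.
Proof.
apply/matrixP => i j.
apply: (@cvg_unique _ (@Rhausdorff R) _ _ _ _ (@expmx_partial A 0 i j)).
apply: cvg_near_cst; exists 1%N => // N /= N1.
rewrite /partial; case: N N1 => // N _; rewrite big_ord_recl/= expr0 expr0 fact0 divr1 scale1r.
by rewrite big1 ?addr0// => l _; rewrite expr0n/= mul0r scale0r.
Qed.

Lemma is_derive_expmx A t i j :
  is_derive t (1 : R) (fun t => expmx A t i j) ((A *m expmx A t) i j).
Proof.
have diffs M : pseries_diffs (coef A M i j) = coef A (M *m A) i j.
  apply/funext => q; rewrite /pseries_diffs /coef factS natrM.
  rewrite -mulmxA mulmxE -exprS -mulmxE invfM mulrCA.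
  by rewrite [X in _ * X]mulrA divff ?mul1r.
have E M t' : (M *m expmx A t') i j = limn (pseries (coef A M i j) t').
  apply/esym/cvg_lim; first exact: Rhausdorff.
  rewrite (_ : pseries _ _ = (fun N => (M *m partial A t' N) i j)).
    exact: cvg_partialMl.
  by apply/funext => N; rewrite partial_coef.
rewrite E (_ : (fun t => expmx A t i j) = (fun t => limn (pseries (coef A 1%:M i j) t))).
  have -> : coef A A i j = pseries_diffs (coef A 1%:M i j) by rewrite diffs mul1mx.
  (* These series converge everywhere, so any radius exceeding [|t|] will do. *)
  apply: (@pseries_snd_diffs _ _ (`|t| + 1)); rewrite ?diffs; try exact: is_cvg_coef.
  by rewrite [ltRHS]ger0_norm ?ltrDl// addr_ge0.
by apply/funext => t'; rewrite -E mul1mx.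
Qed.

Lemma expmx_continuous A i j : continuous (fun t => expmx A t i j).
Proof.
move=> t; apply/differentiable_continuous/derivable1_diffP.
by case: (is_derive_expmx A t i j).
Qed.

Lemma mulmx_continuous p q r (X : R -> 'M[R]_(p, q)) (Y : R -> 'M[R]_(q, r)) :
  (forall i j, continuous (fun t => X t i j)) ->
  (forall i j, continuous (fun t => Y t i j)) ->
  forall i j, continuous (fun t => (X t *m Y t) i j).
Proof.
move=> cX cY i j t.
rewrite (_ : (fun t => _) = (fun t => \sum_l X t i l * Y t l j)); last first.
  by apply/funext => s; rewrite mxE.
rewrite /continuous_at.
apply: cvg_big => [|l _]; first exact: add_continuous.
by apply: cvgM; [exact: cX|exact: cY].
Qed.

Lemma cst_mx_continuous p q (C : 'M[R]_(p, q)) i j : continuous (fun _ : R => C i j).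
Proof. exact: cst_continuous. Qed.

Lemma mprim_expmx b A c : mprim b (fun t => expmx A (t + c))
  (fun t => A *m expmx A (t + c)).
Proof.
move=> i j; have cS : continuous (fun t : R => t + c).
  by move=> t; apply: cvgD; [exact: cvg_id|exact: cvg_cst].
apply: prim_derive => [t|].
  have h1 : is_derive t (1 : R) (fun t => t + c) 1.
    by apply: is_derive_eq (is_deriveD _ _) _; rewrite addr0.
  have h2 := is_derive_expmx A (t + c) i j.
  have := @is_derive1_comp R (fun t => expmx A t i j) (fun t => t + c) t _ _ h2 h1.
  by rewrite mulr1.
apply: mulmx_continuous; first exact: cst_mx_continuous.
move=> l l' t.
by apply: (@continuous_comp _ _ _ (fun t => t + c) (fun t => expmx A t l l'));
  [exact: cS|exact: expmx_continuous].
Qed.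

Lemma mprim_expmxN b A c : mprim b (fun t => expmx A (c - t))
  (fun t => - (A *m expmx A (c - t))).
Proof.
move=> i j; have cS : continuous (fun t : R => c - t).
  by move=> t; apply: cvgB; [exact: cvg_cst|exact: cvg_id].
apply: prim_derive => [t|].
  have h1 : is_derive t (1 : R) (fun t => c - t) (-1).
    by apply: is_derive_eq (is_deriveB _ _) _; rewrite sub0r.
  have h2 := is_derive_expmx A (c - t) i j.
  have := @is_derive1_comp R (fun t => expmx A t i j) (fun t => c - t) t _ _ h2 h1.
  by rewrite mulrN1 [in X in _ -> X]mxE.
rewrite (_ : (fun t => _) = (fun t => - ((A *m expmx A (c - t)) i j))); last first.
  by apply/funext => t; rewrite mxE.
move=> t; apply: cvgN; move: t.
apply: (mulmx_continuous (X := fun=> A)); first exact: cst_mx_continuous.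
move=> l l' t.
by apply: (@continuous_comp _ _ _ (fun t => c - t) (fun t => expmx A t l l'));
  [exact: cS|exact: expmx_continuous].
Qed.

(** The product of [e^(A(r+t))] and [e^(-Ar)] has zero density in [r], because [A] commutes with its
    exponential, so it keeps its value at [r = 0]. This replaces the Cauchy product of the two
    series; the sign condition reflects that [prim] describes functions on [[0, b]]. *)
Lemma expmxDN A s t : 0 <= s -> expmx A (s + t) *m expmx A (- s) = expmx A t.
Proof.
move=> s0; have := mprim_const (t := s) (mprimM (mprim_expmx s A t) (mprim_expmxN s A 0)).
rewrite /= sub0r => ->; rewrite ?s0 ?lexx//.
  by rewrite add0r subrr expmx0 mulmx1.
by move=> r _; rewrite mulmxN mulmxA -expmx_comm subrr.
Qed.

Lemma expmxB A s t : 0 <= s -> expmx A (t - s) = expmx A t *m expmx A (- s).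
Proof. by move=> s0; rewrite -(expmxDN A (t - s) s0) subrKC. Qed.

Lemma expmxNr A s : 0 <= s -> expmx A s *m expmx A (- s) = 1%:M.
Proof. by move=> s0; rewrite -expmxB// subrr expmx0. Qed.

Lemma expmxD A s t : 0 <= s -> expmx A (t + s) = expmx A t *m expmx A s.
Proof.
move=> s0; have e := expmxDN A t s0.
rewrite -e -mulmxA (mulmx1C (expmxNr A s0)) mulmx1.
by rewrite addrC.
Qed.

End MatrixExponential.

(** * Variation of constants *)

Section Duhamel.
Context {R : realType} {k : nat}.
Variables (A : 'M[R]_k) (b : R) (q : nat) (G : R -> 'M[R]_(k, q)).
Hypothesis gG : mgood b G.

Lemma mgood_expmxB t : mgood b (fun s => expmx A (t - s)).
Proof. exact: mprim_good (mprim_expmxN b A t). Qed.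

Let gNG : mgood b (fun s => expmx A (- s) *m G s).
Proof.
apply: mgoodM => //; apply: mgood_ext (mgood_expmxB 0) => t _.
by rewrite sub0r.
Qed.

(** The kernel depends on both [t] and [s]. Pulling [e^(At)] out leaves an integrand free of [t], so
    the product rule gives the density of the convolution. *)
Lemma duhamel_factor t : 0 <= t <= b ->
  vint 0 t (fun s => expmx A (t - s) *m G s) =
  expmx A t *m vint 0 t (fun s => expmx A (- s) *m G s).
Proof.
move=> /andP[t0 tb]; rewrite -(@vintMl _ b)//.
by apply: vint_ext => s /andP[s0 _]; rewrite expmxB// mulmxA.
Qed.

Lemma duhamel_prim :
  mprim b (fun t => vint 0 t (fun s => expmx A (t - s) *m G s))
    (fun t => A *m vint 0 t (fun s => expmx A (t - s) *m G s) + G t).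
Proof.
have pV : mprim b (fun t => vint 0 t (fun s => expmx A (- s) *m G s))
    (fun s => expmx A (- s) *m G s).
  by apply: (mprim_vint (C := 0)) => // t _; rewrite add0r.
have := mprimM (mprim_expmx b A 0) pV.
apply: mprim_ext => t ht; first by rewrite duhamel_factor// addr0.
have t0 : 0 <= t by case/andP: ht.
by rewrite duhamel_factor// addr0 !mulmxA expmxNr// mul1mx.
Qed.

(** With the integrating factor [e^(-At)], the density of [e^(-At) Z] is [e^(-At) G], which no
    longer involves [Z]. *)
Lemma duhamel_unique (Z : R -> 'M[R]_(k, q)) :
  mprim b Z (fun t => A *m Z t + G t) -> forall t, 0 <= t <= b ->
  Z t = expmx A t *m Z 0 + vint 0 t (fun s => expmx A (t - s) *m G s).
Proof.
move=> pZ t ht; have t0 : 0 <= t by case/andP: ht.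
have := mprimM (mprim_expmxN b A 0) pZ.
move=> /mprimE => /(_ _ ht); rewrite !sub0r oppr0 expmx0 mul1mx => e.
rewrite duhamel_factor// -mulmxDr.
have -> : Z t = expmx A t *m (expmx A (- t) *m Z t).
  by rewrite mulmxA expmxNr// mul1mx.
rewrite e; congr (_ *m (_ + _)); apply: vint_ext => s _.
rewrite !sub0r mulmxDr mulNmx !mulmxA -expmx_comm addrA.
by rewrite addNr add0r.
Qed.

End Duhamel.

(** * Exponential decay for Hurwitz matrices *)

Section Decay.
Context {R : realType}.
Implicit Types (X Y V v u w : R -> R) (b t nu c : R).
Local Notation Rint := Defs.Rint.

Definition decays X := exists K nu, [/\ 0 <= K, 0 < nu &
  forall t, 0 <= t -> `|X t| <= K * expR (- nu * t)].

Lemma decays0 : decays (fun=> 0).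
Proof. by exists 0, 1; split => // t _; rewrite normr0 mul0r. Qed.

Lemma decays_le X Y : (forall t, 0 <= t -> `|X t| <= `|Y t|) -> decays Y -> decays X.
Proof.
move=> XY [K [nu [K0 nu0 hY]]]; exists K, nu; split=> // t t0.
exact: le_trans (XY t t0) (hY t t0).
Qed.

Lemma decaysD X Y : decays X -> decays Y -> decays (fun t => X t + Y t).
Proof.
move=> [K [nu [K0 nu0 hX]]] [L [om [L0 om0 hY]]].
exists (K + L), (Num.min nu om); split; first exact: addr_ge0.
  by rewrite lt_min nu0.
move=> t t0; apply: le_trans (ler_normD _ _) _; rewrite mulrDl lerD//.
- apply: le_trans (hX t t0) _; rewrite ler_wpM2l// ler_expR !mulNr lerN2.
  by rewrite ler_wpM2r// ge_min lexx.
- apply: le_trans (hY t t0) _; rewrite ler_wpM2l// ler_expR !mulNr lerN2.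
  by rewrite ler_wpM2r// ge_min lexx orbT.
Qed.

Lemma decays_norm X : decays X -> decays (fun t => `|X t|).
Proof. by apply: decays_le => t _; rewrite normr_id. Qed.

Lemma decays_sum (I : Type) (r : seq I) (F : I -> R -> R) :
  (forall i, decays (F i)) -> decays (fun t => \sum_(i <- r) F i t).
Proof.
move=> dF; elim: r => [|i r IH].
  by apply: decays_le decays0 => t _; rewrite big_nil.
by apply: decays_le (decaysD (dF i) IH) => t _; rewrite big_cons.
Qed.

Lemma expR_linear_continuous c : continuous (fun t => expR (c * t)).
Proof.
move=> t; apply: (@continuous_comp _ _ _ (fun t => c * t) expR).
  by apply: cvgMr; exact: cvg_id.
exact: continuous_expR.
Qed.

Lemma prim_expR b c : prim b (fun t => expR (c * t)) (fun t => c * expR (c * t)).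
Proof.
apply: prim_derive => [t|].
  have h1 : is_derive t (1 : R) (fun t => c * t) c.
    by apply: is_derive_eq (is_deriveM _ _) _; rewrite /= scaler0 addr0 [LHS]mulr1.
  have h2 : is_derive (c * t) (1 : R) expR (expR (c * t)) by exact: is_derive_expR.
  have := @is_derive1_comp R expR (fun t => c * t) t _ _ h2 h1.
  by rewrite mulrC.
by move=> t; apply: cvgMr; exact: expR_linear_continuous.
Qed.

(* The function V e^{nu t} + C/(c - nu) e^{(nu - c) t} is nonincreasing. *)
Lemma gronwall_decay b V v mu c C nu : prim b V v -> nu < mu -> nu < c ->
  (forall t, 0 <= t <= b -> 0 <= V t) ->
  (forall t, 0 <= t <= b -> v t <= - mu * V t + C * expR (- c * t)) ->
  forall t, 0 <= t <= b -> V t * expR (nu * t) + C / (c - nu) * expR ((nu - c) * t)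
     <= V 0 + C / (c - nu).
Proof.
move=> pV num nuc V0 hv t /andP[t0 tb].
have pW := primD (primM pV (prim_expR b nu))
  (primM (prim_cst b (C / (c - nu))) (prim_expR b (nu - c))).
have [gW /(_ t)] := pW; rewrite t0 tb => /(_ isT) ->.
rewrite !mulr0 expR0 !mulr1 gerDl.
apply: (@le_trans _ _ (Rint 0 t (fun=> 0))); last by rewrite Rint0.
apply: (Rint_le (lexx 0) tb gW); first exact: good_cst.
move=> s /andP[s0 st]; have hs : 0 <= s <= b by rewrite s0 (le_trans st).
rewrite mul0r add0r.
have -> : C / (c - nu) * ((nu - c) * expR ((nu - c) * s)) = - C * expR ((nu - c) * s).
  have : c - nu != 0 by rewrite subr_eq0 gt_eqF.
  by move=> ?; field.
have -> : expR ((nu - c) * s) = expR (- c * s) * expR (nu * s).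
  by rewrite -expRD; congr expR; ring.
have := hv s hs; have := V0 s hs; have := expR_gt0 (nu * s).
move: (expR (nu * s)) (expR (- c * s)) => e d e0 Vs vs.
have m0 : 0 <= mu - nu by rewrite subr_ge0 ltW.
have := mulr_ge0 (mulr_ge0 (ltW e0) m0) Vs.
have := mulr_ge0 (ltW e0) (_ : 0 <= - mu * V s + C * d - v s).
by rewrite subr_ge0 => /(_ vs); lra.
Qed.

(** These are the real and imaginary parts of a scalar complex equation with coefficient [a + i be].
    In [V = u^2 + w^2] the rotation [be] cancels. Young's inequality spends half of the damping
    [2 a V] on the forcing, leaving [V' <= a V + C e^(-2 nu t)]. *)
Lemma pair_decay (a be : R) u w g1 g2 : a < 0 ->
  (forall b, prim b u (fun t => a * u t - be * w t + g1 t)) ->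
  (forall b, prim b w (fun t => be * u t + a * w t + g2 t)) ->
  decays g1 -> decays g2 -> decays u /\ decays w.
Proof.
move=> a0 pu pw dg1 dg2.
have [K [nu [K0 nu0 hg]]] := decaysD (decays_norm dg1) (decays_norm dg2).
have hg1 t : 0 <= t -> `|g1 t| <= K * expR (- nu * t).
  by move=> t0; apply: le_trans (hg t t0); rewrite [leRHS]ger0_norm ?addr_ge0// lerDl.
have hg2 t : 0 <= t -> `|g2 t| <= K * expR (- nu * t).
  by move=> t0; apply: le_trans (hg t t0); rewrite [leRHS]ger0_norm ?addr_ge0// lerDr.
pose V t := u t * u t + w t * w t.
pose C := 2 * (K * K) / (- a).
(* [om] must lie strictly below both the damping rate [-a] and the forcing rate [2 nu], even when
   these coincide. *)
pose om := Num.min (- a) (2 * nu) / 2.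
have m0 : 0 < Num.min (- a) (2 * nu) by rewrite lt_min oppr_gt0 a0 mulr_gt0.
have om0 : 0 < om by rewrite divr_gt0.
have oma : om < - a.
  have : Num.min (- a) (2 * nu) <= - a by rewrite ge_min lexx.
  by rewrite /om; lra.
have omnu : om < 2 * nu.
  have : Num.min (- a) (2 * nu) <= 2 * nu by rewrite ge_min lexx orbT.
  by rewrite /om; lra.
have C0 : 0 <= C by rewrite /C divr_ge0 ?oppr_ge0 ?(ltW a0)// !mulr_ge0.
have sq g t : 0 <= t -> `|g| <= K * expR (- nu * t) ->
    g * g <= K * K * expR (- (2 * nu) * t).
  move=> t0 hgt; have -> : - (2 * nu) * t = - nu * t + - nu * t by ring.
  rewrite expRD mulrACA; apply: le_trans (ler_pM _ _ hgt hgt) => //.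
  by rewrite -normrM ler_norm.
have V0 t : 0 <= V t by rewrite addr_ge0// -expr2 sqr_ge0.
have VK t : 0 <= t -> V t <= (V 0 + C / (2 * nu - om)) * expR (- om * t).
  move=> t0.
  have pV := primD (primM (pu t) (pu t)) (primM (pw t) (pw t)).
  have hv s : 0 <= s <= t ->
      (a * u s - be * w s + g1 s) * u s + u s * (a * u s - be * w s + g1 s) +
      ((be * u s + a * w s + g2 s) * w s + w s * (be * u s + a * w s + g2 s))
      <= - - a * V s + C * expR (- (2 * nu) * s).
    move=> /andP[s0 _].
    have := sq _ _ s0 (hg1 s s0); have := sq _ _ s0 (hg2 s s0).
    set D := K * K * _ => h2 h1.
    have -> : C * expR (- (2 * nu) * s) = 2 * D / - a by rewrite /C /D; ring.
    have young x y : y * y <= D -> 2 * (x * y) <= - a * (x * x) + D / - a.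
      move=> hy; have yD : y * y / - a <= D / - a.
        by rewrite ler_wpM2r// invr_ge0 oppr_ge0 ltW.
      apply: le_trans (_ : _ <= - a * (x * x) + y * y / - a) _; last by rewrite lerD2l.
      rewrite -subr_ge0.
      have -> : - a * (x * x) + y * y / - a - 2 * (x * y) = - a * (x - y / - a) ^+ 2.
        by field; rewrite lt_eqF.
      by rewrite mulr_ge0 ?sqr_ge0// oppr_ge0 ltW.
    have := young (u s) _ h1; have := young (w s) _ h2.
    rewrite /V; lra.
  have := gronwall_decay pV oma omnu (fun s _ => V0 s) hv (t := t).
  rewrite t0 lexx => /(_ isT).
  rewrite -/(V t) -/(V 0) => h.
  have e1 : expR (om * t) * expR (- om * t) = 1.
    by rewrite -expRD mulNr subrr expR0.
  have -> : V t = V t * expR (om * t) * expR (- om * t) by rewrite -mulrA e1 mulr1.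
  rewrite ler_wpM2r ?expR_ge0//; apply: le_trans h; rewrite lerDl.
  by rewrite mulr_ge0 ?expR_ge0// divr_ge0// subr_ge0 ltW.
pose M := V 0 + C / (2 * nu - om).
have M0 : 0 <= M by rewrite addr_ge0// divr_ge0// subr_ge0 ltW.
have M1 : 0 <= 1 + M by exact: addr_ge0.
(* Since [M <= (1 + M)^2], the constant [1 + M] serves in place of a square root of [M]; the rate
   halves because [V] is quadratic. *)
have fin x t : 0 <= t -> x * x <= V t -> `|x| <= (1 + M) * expR (- (om / 2) * t).
  move=> t0 hx; rewrite -(ler_pXn2r (n := 2))// ?nnegrE ?mulr_ge0 ?expR_ge0//.
  rewrite real_normK ?num_real// expr2; apply: le_trans hx _; apply: le_trans (VK t t0) _.
  rewrite exprMn expr2 -expRM_natl.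
  have -> : 2 * (- (om / 2) * t) = - om * t by field.
  by rewrite ler_wpM2r ?expR_ge0// -/M; nra.
split; exists (1 + M), (om / 2); split=> //; rewrite ?divr_gt0// => t t0; apply: fin => //.
  by rewrite lerDl -expr2 sqr_ge0.
by rewrite lerDr -expr2 sqr_ge0.
Qed.

End Decay.

Section HurwitzDecay.
Import complex.
Context {R : realType}.
Local Notation CC := (complex.complex R).
Local Notation Re := complex.Re.
Local Notation Im := complex.Im.
Local Notation toC := (fun r : R => complex.Complex r 0).

Let Re_sum (I : Type) (r : seq I) (F : I -> CC) :
  Re (\sum_(i <- r) F i) = \sum_(i <- r) Re (F i).
Proof. by apply: big_morph => // -[a b] [c d]. Qed.

Let Im_sum (I : Type) (r : seq I) (F : I -> CC) :
  Im (\sum_(i <- r) F i) = \sum_(i <- r) Im (F i).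
Proof. by apply: big_morph => // -[a b] [c d]. Qed.

Let map_Re_mul k (M : 'M[CC]_k) (A : 'M[R]_k) :
  map_mx (@complex.Re R) (M *m map_mx toC A) = map_mx (@complex.Re R) M *m A.
Proof.
apply/matrixP => i j; rewrite !mxE Re_sum; apply: eq_bigr => l _; rewrite !mxE.
by case: (M i l) => a b /=; rewrite mulr0 subr0.
Qed.

Let map_Im_mul k (M : 'M[CC]_k) (A : 'M[R]_k) :
  map_mx (@complex.Im R) (M *m map_mx toC A) = map_mx (@complex.Im R) M *m A.
Proof.
apply/matrixP => i j; rewrite !mxE Im_sum; apply: eq_bigr => l _; rewrite !mxE.
by case: (M i l) => a b /=; rewrite mulr0 add0r.
Qed.

(* If M annihilates prod (A - z) then M' := M (A - z) annihilates a shorter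
   product and M A = z M + M', so M e^{At} solves a stable scalar equation
   driven by M' e^{At}. *)
Lemma annihilated_expmx_decay k (A : 'M[R]_k) (s : seq CC) (M : 'M[CC]_k) :
  (forall z : CC, z \in s -> Re z < 0) ->
  M *m \prod_(z <- s) (map_mx toC A - z%:M) = 0 ->
  forall i j, decays (fun t => (map_mx (@complex.Re R) M *m expmx A t) i j) /\
              decays (fun t => (map_mx (@complex.Im R) M *m expmx A t) i j).
Proof.
elim: s M => [|z s IH] M hs.
  rewrite big_nil mulmx1 => -> i j.
  have e (h : CC -> R) : h 0 = 0 -> map_mx h (0 : 'M[CC]_k) = 0.
    by move=> h0; apply/matrixP => a b; rewrite !mxE h0.
  by rewrite !e//; split; apply: decays_le decays0 => t _; rewrite mul0mx mxE.
rewrite big_cons -mulmxE mulmxA => h0 i j.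
have := IH (M *m (map_mx toC A - z%:M)) _ h0 i j.
case; first by move=> y ys; apply: hs; rewrite inE ys orbT.
set N := M *m (map_mx toC A - z%:M).
have eM : M *m map_mx toC A = z *: M + N.
  by rewrite /N mulmxBr mul_mx_scalar subrKC.
set P := map_mx (@complex.Re R) M; set Q := map_mx (@complex.Im R) M.
set P' := map_mx (@complex.Re R) N; set Q' := map_mx (@complex.Im R) N.
have eP : P *m A = Re z *: P - Im z *: Q + P'.
  rewrite -map_Re_mul eM; apply/matrixP => a b; rewrite !mxE.
  by case: (z) (M a b) => zr zi [mr mi] /=; case: (\sum_j0 _).
have eQ : Q *m A = Im z *: P + Re z *: Q + Q'.
  rewrite -map_Im_mul eM; apply/matrixP => a b; rewrite !mxE.
  case: (z) (M a b) => zr zi [mr mi] /=; case: (\sum_j0 _) => nr ni /=.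
  by rewrite [zr * mi + _]addrC.
apply: (@pair_decay _ (Re z) (Im z)).
- by apply: hs; rewrite inE eqxx.
- move=> b; apply: prim_ext (mprimMl P (mprim_expmx b A 0) i j) => t _.
    by rewrite addr0.
  by rewrite addr0 mulmxA eP !mulmxDl mulNmx -!scalemxAl !mxE.
- move=> b; apply: prim_ext (mprimMl Q (mprim_expmx b A 0) i j) => t _.
    by rewrite addr0.
  by rewrite addr0 mulmxA eQ !mulmxDl -!scalemxAl !mxE.
Qed.

Lemma hurwitz_expmx_decay k (A : 'M[R]_k) : hurwitz A ->
  exists K nu, [/\ 0 <= K, 0 < nu &
    forall t, 0 <= t -> \sum_i \sum_j `|expmx A t i j| <= K * expR (- nu * t)].
Proof.
case: k A => [|k] A hA.
  by exists 0, 1; split=> // t _; rewrite big_ord0 mul0r.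
have [r er] := closed_field_poly_normal (char_poly (map_mx toC A)).
rewrite (monicP (char_poly_monic _)) scale1r in er.
have hr z : z \in r -> Re z < 0.
  by move=> zr; apply: hA; rewrite er root_prod_XsubC.
have CH : 1%:M *m \prod_(z <- r) (map_mx toC A - z%:M) = 0.
  rewrite mul1mx -(Cayley_Hamilton (map_mx toC A)) er rmorph_prod/=.
  by apply: eq_bigr => z _; rewrite rmorphB/= horner_mx_X horner_mx_C.
have dE i j : decays (fun t => expmx A t i j).
  have [+ _] := annihilated_expmx_decay hr CH i j.
  have -> : map_mx (@complex.Re R) (1%:M : 'M[CC]_k.+1) = 1%:M.
    by apply/matrixP => a b; rewrite !mxE; case: (_ == _).
  by apply: decays_le => t _; rewrite mul1mx.
have : decays (fun t => \sum_i \sum_j `|expmx A t i j|).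
  by apply: decays_sum => i; apply: decays_sum => j; exact: decays_norm.
move=> [K [nu [K0 nu0 hK]]]; exists K, nu; split=> // t t0.
exact: le_trans (ler_norm _) (hK t t0).
Qed.

End HurwitzDecay.

(** * Stable operators and the L1 norm *)

Section Norms.
Context {R : realType}.
Implicit Types (k : nat) (c : R).

Lemma vnorm_ge0 k (x : 'cV[R]_k) : 0 <= vnorm x.
Proof. exact: bigmax_ge_id. Qed.

Lemma ler_vnorm k (x : 'cV[R]_k) i : `|x i 0| <= vnorm x.
Proof. exact: (le_bigmax 0 (fun i => `|x i 0|)). Qed.

Lemma vnorm_le k (x : 'cV[R]_k) c : 0 <= c -> (forall i, `|x i 0| <= c) ->
  vnorm x <= c.
Proof. by move=> c0 h; apply: bigmax_le. Qed.

Lemma vnorm0 k : vnorm (0 : 'cV[R]_k) = 0.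
Proof.
by apply/eqP; rewrite eq_le vnorm_ge0 andbT vnorm_le// => i; rewrite mxE normr0.
Qed.

Lemma vnormD k (x y : 'cV[R]_k) : vnorm (x + y) <= vnorm x + vnorm y.
Proof.
apply: vnorm_le => [|i]; first by rewrite addr_ge0 ?vnorm_ge0.
by rewrite mxE; apply: le_trans (ler_normD _ _) _; rewrite lerD ?ler_vnorm.
Qed.

Lemma vnormZ k c (x : 'cV[R]_k) : vnorm (c *: x) <= `|c| * vnorm x.
Proof.
apply: vnorm_le => [|i]; first by rewrite mulr_ge0 ?vnorm_ge0.
by rewrite mxE normrM ler_wpM2l ?ler_vnorm.
Qed.

Lemma vnormN k (x : 'cV[R]_k) : vnorm (- x) = vnorm x.
Proof. by rewrite /vnorm; apply: eq_bigr => i _; rewrite mxE normrN. Qed.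

Lemma vnormB k (x y : 'cV[R]_k) : vnorm (x - y) <= vnorm x + vnorm y.
Proof. by rewrite -(vnormN y); exact: vnormD. Qed.

Lemma vnorm_eq0 k (x : 'cV[R]_k) : vnorm x <= 0 -> x = 0.
Proof.
move=> x0; apply/matrixP => i j; rewrite ord1 mxE; apply/eqP.
by rewrite -normr_le0 (le_trans (ler_vnorm _ _)).
Qed.

Lemma mnorm_ge0 p q (A : 'M[R]_(p, q)) : 0 <= mnorm A.
Proof. exact: bigmax_ge_id. Qed.

Lemma ler_mnorm p q (A : 'M[R]_(p, q)) i : \sum_j `|A i j| <= mnorm A.
Proof. exact: (le_bigmax 0 (fun i => \sum_j `|A i j|)). Qed.

Lemma ler_vnormM p q (A : 'M[R]_(p, q)) x : vnorm (A *m x) <= mnorm A * vnorm x.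
Proof.
apply: vnorm_le => [|i]; first by rewrite mulr_ge0 ?vnorm_ge0 ?mnorm_ge0.
rewrite mxE; apply: le_trans (ler_norm_sum _ _ _) _.
apply: (@le_trans _ _ (\sum_j `|A i j| * vnorm x)).
  by apply: ler_sum => j _; rewrite normrM ler_wpM2l// ler_vnorm.
by rewrite -mulr_suml ler_wpM2r ?vnorm_ge0 ?ler_mnorm.
Qed.

Lemma maxc_ge0 k (c : 'I_k -> R) : 0 <= maxc c.
Proof. exact: bigmax_ge_id. Qed.

Lemma ler_maxc k (c : 'I_k -> R) i : c i <= maxc c.
Proof. exact: le_bigmax. Qed.

Lemma ler_supnorm k (y : R -> 'cV[R]_k) M t :
  (forall s, 0 <= s -> vnorm (y s) <= M) -> 0 <= t -> vnorm (y t) <= supnorm y.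
Proof.
move=> hM t0; apply: ub_le_sup; last by exists t.
by exists M => r [s s0 ->]; exact: hM.
Qed.

Lemma supnorm_le k (y : R -> 'cV[R]_k) M :
  (forall s, 0 <= s -> vnorm (y s) <= M) -> supnorm y <= M.
Proof.
move=> hM; apply: ge_sup; first by exists (vnorm (y 0)), 0.
by move=> r [s s0 ->]; exact: hM.
Qed.

End Norms.

(** * Causal linear operators of finite gain *)

Section StableOperators.
Context {R : realType}.

(** The gain [K] is the same for all [b], which makes the L1 norm finite. The bound itself is local:
    the output on [[0, b]] is controlled by the input on [[0, b]] alone. *)
Record stable_op {a c} (H : (R -> 'cV[R]_a) -> R -> 'cV[R]_c) : Prop := StableOp {
  stable_good : forall b u, mgood b u -> mgood b (H u);
  stable_linear : forall b r u w, mgood b u -> mgood b w ->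
    forall t, 0 <= t <= b -> H (fun s => r *: u s + w s) t = r *: H u t + H w t;
  stable_bounded : exists2 K, 0 <= K & forall b u M, mgood b u ->
    (forall s, 0 <= s <= b -> vnorm (u s) <= M) ->
    forall t, 0 <= t <= b -> vnorm (H u t) <= K * M }.

Section Basic.
Context {a c : nat} {H : (R -> 'cV[R]_a) -> R -> 'cV[R]_c}.
Hypothesis sH : stable_op H.

(** Causality: the difference of the inputs vanishes on [[0, b]], so by linearity and the local gain
    bound so does the difference of the outputs. *)
Lemma stable_ext b u w t : mgood b u -> (forall s, 0 <= s <= b -> u s = w s) ->
  0 <= t <= b -> H u t = H w t.
Proof.
move=> gu e ht; have gw : mgood b w by apply: mgood_ext gu.
have [K K0 hK] := stable_bounded sH.
apply/eqP; rewrite -subr_eq0 -scaleN1r addrC -(stable_linear sH _ gw gu)//.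
apply/eqP/vnorm_eq0; rewrite -(mulr0 K); apply: (hK b) => //.
  by apply: mgoodD => //; exact: mgoodZ.
by move=> s hs; rewrite e// scaleN1r addNr vnorm0.
Qed.

Lemma stableD b u w t : mgood b u -> mgood b w -> 0 <= t <= b ->
  H (fun s => u s + w s) t = H u t + H w t.
Proof.
move=> gu gw ht; rewrite -[H u t]scale1r -(stable_linear sH _ gu gw)//.
by apply: (stable_ext (b := b)) => //; [exact: mgoodD|move=> s _; rewrite scale1r].
Qed.

Lemma stableZ b r u t : mgood b u -> 0 <= t <= b ->
  H (fun s => r *: u s) t = r *: H u t.
Proof.
move=> gu ht; have g0 : mgood b (fun=> 0 : 'cV[R]_a) by exact: mgood_cst.
have := stable_linear sH (-1) g0 g0 ht.
rewrite (@stable_ext b _ (fun=> 0))//; last first.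
- by move=> s _; rewrite scaler0 addr0.
- by apply: mgoodD => //; exact: mgoodZ.
rewrite scaleN1r addNr => h0.
have := stable_linear sH r gu g0 ht; rewrite h0 addr0 => <-.
by apply: (stable_ext (b := b)) => //; [exact: mgoodZ|move=> s _; rewrite addr0].
Qed.

Lemma stableB b u w t : mgood b u -> mgood b w -> 0 <= t <= b ->
  H (fun s => u s - w s) t = H u t - H w t.
Proof.
move=> gu gw ht; rewrite (stableD (b := b))//; last exact: mgoodN.
congr (_ + _); rewrite -scaleN1r -(stableZ (b := b))//.
by apply: (stable_ext (b := b)) => //; [exact: mgoodN|move=> s _; rewrite scaleN1r].
Qed.

(* Truncating the input outside [0, b] and rescaling it makes it admissible in
   the supremum defining [l1norm]; boundedness makes that supremum meaningful. *)
Lemma l1norm_bound b u M t : mgood b u ->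
  (forall s, 0 <= s <= b -> vnorm (u s) <= M) -> 0 <= t <= b ->
  vnorm (H u t) <= l1norm H * M.
Proof.
move=> gu uM ht; have [K K0 hK] := stable_bounded sH.
have M0 : 0 <= M by apply: le_trans (uM t ht); exact: vnorm_ge0.
(* The rescaling divides by [M]; when [M = 0] the gain bound already makes the output zero. *)
move: M0; rewrite le_eqVlt => /predU1P[M0|M0].
  by rewrite -M0 mulr0 -(mulr0 K); apply: (hK b) => // s hs; rewrite M0 uM.
pose u' s : 'cV[R]_a := if (0 <= s <= b) then M^-1 *: u s else 0.
have mu' i : measurable_fun setT (fun s => u' s i 0).
  have [mi _] := mgoodZ M^-1 gu i 0.
  have := (measurable_restrictT _ (measurable_itv `[0, b])).1 mi.
  apply: eq_measurable_fun => s _; rewrite patchE mem_setE in_itv/= /u'.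
  by case: ifP; rewrite // mxE.
have u'1 s : vnorm (u' s) <= 1.
  rewrite /u'; case: ifPn => [hs|_]; last by rewrite vnorm0.
  apply: le_trans (vnormZ _ _) _; rewrite ger0_norm ?invr_ge0 ?(ltW M0)//.
  by rewrite ler_pdivrMl// mulr1 uM.
have adm_good b' (w : R -> 'cV[R]_a) :
    (forall i, measurable_fun setT (fun t => w t i 0)) ->
    (forall t, 0 <= t -> vnorm (w t) <= 1) -> mgood b' w.
  move=> mw w1 i j; rewrite ord1; split.
    exact: measurable_funS (mw i).
  by exists 1 => s /andP[s0 _]; apply: le_trans (w1 s s0); exact: ler_vnorm.
have adm_bound (w : R -> 'cV[R]_a) : (forall i, measurable_fun setT (fun t => w t i 0)) ->
    (forall t, 0 <= t -> vnorm (w t) <= 1) ->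
    forall s, 0 <= s -> vnorm (H w s) <= K.
  move=> mw w1 s s0; rewrite -[K]mulr1; apply: (hK s) => //; last by rewrite s0 lexx.
    exact: adm_good.
  by move=> r /andP[r0 _]; exact: w1.
have e : H u t = M *: H u' t.
  rewrite -(stableZ (b := b))//; last by apply: adm_good.
  apply: (stable_ext (b := b)) => // s hs; rewrite /u' hs scalerA divff ?scale1r//.
  by rewrite gt_eqF.
have [t0 _] := andP ht.
rewrite e; apply: le_trans (vnormZ _ _) _; rewrite gtr0_norm// mulrC ler_pM2r//.
apply: le_trans (ler_supnorm (M := K) _ t0) _; first by apply: adm_bound.
apply: ub_le_sup; last by exists u'.
by exists K => r [w [mw w1 ->]]; apply: supnorm_le; exact: adm_bound.
Qed.

Lemma l1norm_ge0 : 0 <= l1norm H.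
Proof.
rewrite -[l1norm H]mulr1; apply: le_trans (vnorm_ge0 (H (fun=> 0) 0)) _.
apply: (@l1norm_bound 0); rewrite ?lexx//; first exact: mgood_cst.
by move=> s _; rewrite vnorm0.
Qed.

End Basic.

Lemma stable_comp a b c (H1 : (R -> 'cV[R]_b) -> R -> 'cV[R]_c)
  (H2 : (R -> 'cV[R]_a) -> R -> 'cV[R]_b) :
  stable_op H1 -> stable_op H2 -> stable_op (compop H1 H2).
Proof.
move=> s1 s2; split; rewrite /compop.
- by move=> d u /(stable_good s2)/(stable_good s1).
- move=> d r u w gu gw t ht.
  have g1 := stable_good s2 gu; have g2 := stable_good s2 gw.
  rewrite -(stable_linear s1 r g1 g2)//; apply: (stable_ext s1 (b := d)) => //.
    by apply: (stable_good s2); apply: mgoodD => //; exact: mgoodZ.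
  by move=> s hs; rewrite (stable_linear s2 _ gu gw).
- have [K1 K10 h1] := stable_bounded s1; have [K2 K20 h2] := stable_bounded s2.
  exists (K1 * K2); first exact: mulr_ge0.
  move=> d u M gu uM t ht; rewrite -mulrA; apply: (h1 d) => //.
    exact: stable_good.
  by move=> s hs; apply: (h2 d).
Qed.

Lemma stable_premul a b c (M : 'M[R]_(c, b)) (H : (R -> 'cV[R]_a) -> R -> 'cV[R]_b) :
  stable_op H -> stable_op (premul M H).
Proof.
move=> sH; split; rewrite /premul.
- by move=> d u /(stable_good sH); exact: mgoodMl.
- move=> d r u w gu gw t ht.
  by rewrite (stable_linear sH _ gu gw)// mulmxDr -scalemxAr.
- have [K K0 h] := stable_bounded sH; exists (mnorm M * K).
    by rewrite mulr_ge0 ?mnorm_ge0.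
  move=> d u c' gu uM t ht; apply: le_trans (ler_vnormM _ _) _.
  by rewrite -mulrA ler_wpM2l ?mnorm_ge0// (h d).
Qed.

Lemma stable_idB a (H : (R -> 'cV[R]_a) -> R -> 'cV[R]_a) :
  stable_op H -> stable_op (fun u t => u t - H u t).
Proof.
move=> sH; split.
- by move=> d u gu; apply: mgoodB => //; exact: stable_good.
- move=> d r u w gu gw t ht.
  by rewrite (stable_linear sH _ gu gw)// scalerBr addrACA opprD.
- have [K K0 h] := stable_bounded sH; exists (1 + K); first exact: addr_ge0.
  move=> d u c' gu uM t ht; apply: le_trans (vnormB _ _) _.
  by rewrite mulrDl mul1r lerD ?uM// (h d).
Qed.

End StableOperators.

(** * Stability of state-space realisations *)

Section LTI.
Context {R : realType} {k : nat}.
Variable Ar : 'M[R]_k.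
Local Notation Rint := Defs.Rint.

Lemma lti_state a c (Br : 'M[R]_(k, a)) (Cr : 'M[R]_(c, k)) Dr u t :
  lti Ar Br Cr Dr u t =
  Cr *m vint 0 t (fun s => expmx Ar (t - s) *m (Br *m u s)) + Dr *m u t.
Proof.
by rewrite /lti; congr (_ *m _ + _); apply: vint_ext => s _; rewrite mulmxA.
Qed.

Lemma Rint_expR_le (nu t : R) : 0 < nu -> 0 <= t ->
  Rint 0 t (fun s => expR (- nu * (t - s))) <= nu^-1.
Proof.
move=> nu0 t0.
have pX := primZ (expR (- nu * t) / nu) (prim_expR t nu).
have := prim_incr pX (lexx 0) t0 (lexx t).
have nu1 : nu != 0 by rewrite gt_eqF.
rewrite (@Rint_ext _ _ _ _ (fun s => expR (- nu * (t - s)))); last first.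
  move=> s _; rewrite mulrA mulfVK// -expRD; congr expR; ring.
move=> <-; rewrite mulrAC -expRD mulNr addNr expR0 mul1r gerBl.
by rewrite mulr_ge0 ?expR_ge0// divr_ge0 ?expR_ge0// ltW.
Qed.

(** The kernel is bounded by [K e^(-nu (t - s))], whose integral over [[0, t]] is at most [K / nu]
    whatever [t] is; this gives a gain independent of the horizon. *)
Lemma stable_lti a c (Br : 'M[R]_(k, a)) (Cr : 'M[R]_(c, k)) Dr :
  hurwitz Ar -> stable_op (lti Ar Br Cr Dr).
Proof.
move=> hA; split.
- move=> b u gu.
  apply: mgood_ext (_ : mgood b (fun t => Cr *m vint 0 t
      (fun s => expmx Ar (t - s) *m (Br *m u s)) + Dr *m u t)).
    by move=> t _; rewrite lti_state.
  apply: mgoodD; last exact: mgoodMl.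
  apply: mgoodMl; apply: mprim_good (duhamel_prim _ _); exact: mgoodMl.
- move=> b r u w gu gw t /andP[t0 tb]; rewrite /lti.
  have gE v : mgood b v -> mgood b (fun s => expmx Ar (t - s) *m Br *m v s).
    move=> gv; apply: mgoodM => //; apply: mgoodM; last exact: mgood_cst.
    exact: mgood_expmxB.
  rewrite (@vint_ext _ _ _ _ _ _ (fun s => r *: (expmx Ar (t - s) *m Br *m u s) +
     expmx Ar (t - s) *m Br *m w s)); last first.
    by move=> s _; rewrite mulmxDr -scalemxAr.
  rewrite (@vintD _ b)//; try exact: gE; last by apply: mgoodZ; exact: gE.
  rewrite (@vintZ _ b)//; last exact: gE.
  by rewrite !mulmxDr -!scalemxAr scalerDr addrACA.
- have [K [nu [K0 nu0 hK]]] := hurwitz_expmx_decay hA.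
  have nuV : 0 <= nu^-1 by rewrite invr_ge0 ltW.
  exists (mnorm Cr * (K * mnorm Br / nu) + mnorm Dr).
    by rewrite addr_ge0 ?mnorm_ge0// ?mulr_ge0 ?mnorm_ge0.
  move=> b u M gu uM t ht; have [t0 tb] := andP ht.
  have M0 : 0 <= M by apply: le_trans (uM t ht); exact: vnorm_ge0.
  rewrite lti_state mulrDl; apply: le_trans (vnormD _ _) _; apply: lerD; last first.
    by apply: le_trans (ler_vnormM _ _) _; rewrite ler_wpM2l ?mnorm_ge0 ?uM.
  apply: le_trans (ler_vnormM _ _) _; rewrite -[leRHS]mulrA.
  apply: ler_wpM2l; first exact: mnorm_ge0.
  have gI : mgood b (fun s => expmx Ar (t - s) *m (Br *m u s)).
    by apply: mgoodM; [exact: mgood_expmxB|exact: mgoodMl].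
  apply: vnorm_le => [|i]; first by rewrite !mulr_ge0 ?mnorm_ge0.
  rewrite mxE; apply: le_trans (Rint_norm (lexx 0) tb (gI i 0)) _.
  have gexp : good b (fun s => expR (- nu * (t - s))).
    apply: good_continuous => s.
    apply: (@continuous_comp _ _ _ (fun s => t - s) (fun s => expR (- nu * s))).
      by apply: cvgB; [exact: cvg_cst|exact: cvg_id].
    exact: expR_linear_continuous.
  apply: (@le_trans _ _ (Rint 0 t (fun s => K * mnorm Br * M * expR (- nu * (t - s))))).
    apply: (Rint_le (lexx 0) tb); first exact: good_norm.
      by apply: goodM => //; exact: good_cst.
    move=> s /andP[s0 st]; rewrite mxE; apply: le_trans (ler_norm_sum _ _ _) _.
    apply: (@le_trans _ _ (\sum_j `|expmx Ar (t - s) i j| * (mnorm Br * M))).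
      apply: ler_sum => j _; rewrite normrM ler_wpM2l//.
      apply: le_trans (ler_vnorm _ _) _; apply: le_trans (ler_vnormM _ _) _.
      by rewrite ler_wpM2l ?mnorm_ge0// uM// s0 (le_trans st).
    rewrite -mulr_suml.
    have -> : K * mnorm Br * M * expR (- nu * (t - s)) =
        K * expR (- nu * (t - s)) * (mnorm Br * M) by ring.
    rewrite ler_wpM2r ?mulr_ge0 ?mnorm_ge0//.
    apply: le_trans (hK (t - s) _); last by rewrite subr_ge0.
    by rewrite [leRHS](bigD1 i)//= lerDl sumr_ge0// => *; rewrite sumr_ge0.
  rewrite (RintZ (b := b))//.
  have -> : K * mnorm Br / nu * M = K * mnorm Br * M * nu^-1 by ring.
  by rewrite ler_wpM2l ?mulr_ge0 ?mnorm_ge0// Rint_expR_le.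
Qed.

End LTI.

Section HurwitzDiag.
Context {R : realType}.
Import complex.

Lemma hurwitz_Ndiag k (d : 'rV[R]_k) : (forall j, 0 < d 0 j) -> hurwitz (- diag_mx d).
Proof.
move=> d0 z; rewrite char_poly_trig; last first.
  apply/is_trig_mxP => i j ij; rewrite !mxE.
  by rewrite -val_eqE (ltn_eqF ij) mulr0n oppr0.
rewrite rootE horner_prod => /prodf_eq0/= [i _].
rewrite !hornerE subr_eq0 => /eqP ->; rewrite !mxE eqxx mulr1n/=.
by rewrite oppr_lt0.
Qed.

Lemma hurwitz_Nscalar (c : R) : 0 < c -> hurwitz (- (c%:M : 'M[R]_1)).
Proof.
move=> c0; rewrite -diag_const_mx; apply: hurwitz_Ndiag => j.
by rewrite mxE.
Qed.

(** A kernel vector would make [0] an eigenvalue of the complexified matrix, and its real part is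
    not negative. *)
Lemma hurwitz_unitmx k (A : 'M[R]_k) : hurwitz A -> A \in unitmx.
Proof.
move=> hA; rewrite unitmxE unitfE; apply/negP => /det0P[w w0 wA].
suff : root (char_poly (map_mx (fun r : R => Complex r 0) A)) 0.
  by move=> /hA /=; rewrite ltxx.
rewrite -eigenvalue_root_char; apply/eigenvalueP.
exists (map_mx (fun r : R => Complex r 0) w).
  rewrite scale0r; have /= e := map_mxM (real_complex R) w A.
  by rewrite -[LHS]e wA map_mx0.
by have /= -> := map_mx_eq0 (real_complex R) w.
Qed.

End HurwitzDiag.

(** * The sampled prediction error *)

Section ExpmxIntegrals.
Context {R : realType} {k : nat}.
Implicit Types (A : 'M[R]_k) (T t s : R).
Local Notation Rint := Defs.Rint.

Lemma expmx_periodic A T (w : 'rV[R]_k) N : 0 <= T -> w *m expmx A T = w ->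
  w *m expmx A (N%:R * T) = w.
Proof.
move=> T0 e; elim: N => [|N IH]; first by rewrite mul0r expmx0 mulmx1.
by rewrite -natr1 mulrDl mul1r expmxD// mulmxA IH.
Qed.

(** A row vector killed by [e^(AT) - 1] is fixed by every [e^(N T A)], yet these matrices tend to
    zero. No description of the spectrum of the exponential is involved. *)
Lemma PhiT_unitmx A T : hurwitz A -> 0 < T -> PhiT A T \in unitmx.
Proof.
move=> hA T0; rewrite unitmx_mul unitmx_inv hurwitz_unitmx//=.
rewrite unitmxE unitfE; apply/negP => /det0P[w w0].
rewrite mulmxBr mulmx1 => /subr0_eq we.
have [K [nu [K0 nu0 hK]]] := hurwitz_expmx_decay hA.
case/negP: w0; apply/eqP/matrixP => i j; rewrite (ord1 i) [RHS]mxE.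
apply/eqP; rewrite -normr_le0; apply/ler_addgt0Pr => e e0; rewrite add0r.
pose S := \sum_l `|w 0 l|.
have S0 : 0 <= S by rewrite sumr_ge0.
have bound N : `|w 0 j| <= S * K * expR (- nu * (N%:R * T)).
  rewrite -[in X in `|X|](expmx_periodic N (ltW T0) we) mxE.
  apply: le_trans (ler_norm_sum _ _ _) _.
  have NT0 : 0 <= N%:R * T by rewrite mulr_ge0// ltW.
  rewrite -mulrA mulr_suml; apply: ler_sum => l _; rewrite normrM ler_wpM2l//.
  apply: le_trans (hK _ NT0); rewrite [leRHS](bigD1 l)//= [X in X + _](bigD1 j)//=.
  rewrite -addrA lerDl addr_ge0// sumr_ge0// => *; rewrite sumr_ge0//.
(* Chosen so that [S K <= e nu (N + 1) T]; with [1 + y <= exp y] this brings the bound at index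
   [N + 1] below [e]. *)
pose N := Num.truncn (S * K / (e * (nu * T))).
apply: le_trans (bound N.+1) _.
have nT : 0 < nu * T by rewrite mulr_gt0.
have hN : S * K / (e * (nu * T)) < N.+1%:R by rewrite truncnS_gt.
rewrite mulNr expRN ler_pdivrMr ?expR_gt0//.
apply: le_trans (_ : e * (1 + nu * (N.+1%:R * T)) <= _); last first.
  by rewrite ler_wpM2l ?(ltW e0)// expR_ge1Dx.
move: hN; rewrite ltr_pdivrMr ?mulr_gt0// => /ltW hN; apply: le_trans hN _.
rewrite mulrDr mulr1 [leLHS](_ : _ = e * (nu * (N.+1%:R * T))); last by ring.
by rewrite lerDr ltW.
Qed.

(** [PhiT] is the response to a constant input over one sampling period. Hence holding
    [- Phi^-1 e^(AT) z] for a period produces exactly [- e^(AT) z], the opposite of the propagated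
    error. *)
Lemma vint_expmx_PhiT A a T : A \in unitmx -> 0 <= a -> 0 <= T ->
  vint a (a + T) (fun s => expmx A (a + T - s)) = PhiT A T.
Proof.
move=> uA a0 T0; have pE := mprim_expmxN (a + T) A (a + T).
have gE := mprim_good pE.
have aT : a <= a + T by rewrite lerDl.
rewrite /PhiT -[LHS](mulKmx uA); congr (_ *m _).
rewrite -(@vintMl _ (a + T))// -[LHS]opprK -(@vintN _ (a + T))//; last exact: mgoodMl.
rewrite -(mprim_incr pE)// subrr expmx0 opprB.
by have -> : a + T - a = T by rewrite addrC addKr.
Qed.

Lemma Rint_shift a t (h : R -> R) : continuous h -> a <= t ->
  Rint a t (fun s => h (t - s)) = Rint 0 (t - a) (fun s => h (t - a - s)).
Proof.
move=> ch at_.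
have dF : derive1 (fun s : R => s + a) = cst (1 : R).
  apply/funext => s; rewrite derive1E deriveD//.
  by rewrite derive_id derive_cst addr0.
have cF : continuous (fun s : R => s + a).
  by move=> s; apply: cvgD; [exact: cvg_id|exact: cvg_cst].
have := @integration_by_substitution_increasing R (fun s => s + a)
  (fun s => h (t - s)) 0 (t - a).
rewrite subr_ge0 => /(_ at_); rewrite add0r subrK dF => H.
rewrite /Rint /Rintegral H.
- congr fine; apply: eq_integral => s _; congr EFin; rewrite /= mulr1.
  by congr h; ring.
- by move=> x y _ _; rewrite ltrD2r.
- by move=> x _; exact: cst_continuous.
- exact: is_cvg_cst.
- exact: is_cvg_cst.
- split=> [s _||].
  + exact: derivableD.
  + by apply: cvg_at_right_filter; exact: cF.
  + by apply: cvg_at_left_filter; exact: cF.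
- apply: continuous_subspaceT => s.
  apply: (@continuous_comp _ _ _ (fun s => t - s) h); last exact: ch.
  by apply: cvgB; [exact: cvg_cst|exact: cvg_id].
Qed.

(** The adaptive law is constant on half-open periods and jumps at the right end, where the integral
    does not see it. *)
Lemma Rint_ext_co b s t (u w : R -> R) : 0 <= s -> t <= b -> good b u -> good b w ->
  (forall r, s <= r < t -> u r = w r) -> Rint s t u = Rint s t w.
Proof.
move=> s0 tb gu gw e.
have i1 v : good b v -> lebesgue_measure.-integrable `[s, t[ (EFin \o v).
  move=> gv; apply: integrableS (good_integrable gv s0 tb) => //.
  by apply: subset_itvl; rewrite bnd_simp.
rewrite /Rint -!Rintegral_itv_bndo_bndc; try exact: i1.
by apply: eq_Rintegral => r; rewrite inE/= in_itv/=; exact: e.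
Qed.

Lemma mnorm_continuous p q (M : R -> 'M[R]_(p, q)) :
  (forall i j, continuous (fun t => M t i j)) -> continuous (fun t => mnorm (M t)).
Proof.
move=> cM t; rewrite /continuous_at /mnorm.
have cmax (x y : R -> R) : {for t, continuous x} -> {for t, continuous y} ->
    {for t, continuous (fun s => Num.max (x s) (y s))}.
  move=> cx cy; rewrite (_ : (fun s => _) = (fun s => (x s + y s + `|x s - y s|) / 2)).
    by apply: cvgMl; apply: cvgD; [exact: cvgD|apply: cvg_norm; exact: cvgB].
  by apply/funext => s; rewrite maxr_absE.
suff H (r : seq 'I_p) : {for t, continuous
    (fun s => \big[Num.max/0]_(i <- r) \sum_(j < q) `|M s i j|)} by exact: H.
elim: r => [|i r IH].
  rewrite (_ : (fun s => _) = cst 0); first exact: cst_continuous.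
  by apply/funext => s; rewrite big_nil.
rewrite (_ : (fun s => _) = (fun s => Num.max (\sum_(j < q) `|M s i j|)
  (\big[Num.max/0]_(i <- r) \sum_(j < q) `|M s i j|))); last first.
  by apply/funext => s; rewrite big_cons.
apply: cmax => //; apply: cvg_big => [|j _]; first exact: add_continuous.
by apply: cvg_norm; exact: cM.
Qed.

Lemma vnorm_vintM b p q s t c (M : R -> 'M[R]_(p, q)) g :
  0 <= s -> s <= t -> t <= b -> (forall i j, continuous (fun t => M t i j)) ->
  mgood b g -> (forall r, s <= r <= t -> vnorm (g r) <= c) ->
  vnorm (vint s t (fun r => M r *m g r)) <= c * Rint s t (fun r => mnorm (M r)).
Proof.
move=> s0 st tb cM gg gc.
have c0 : 0 <= c by apply: le_trans (gc s _); rewrite ?vnorm_ge0 ?lexx.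
have gM : mgood b M by move=> i j; exact: good_continuous.
have gN : good b (fun r => mnorm (M r)).
  by apply: good_continuous; exact: mnorm_continuous.
apply: vnorm_le => [|i].
  by rewrite mulr_ge0// Rint_ge0// => r _; exact: mnorm_ge0.
have gMg := mgoodM gM gg.
rewrite mxE; apply: le_trans (Rint_norm s0 tb (gMg i 0)) _.
rewrite -(@RintZ _ b)//; apply: (Rint_le s0 tb); first exact: good_norm.
  by apply: goodM => //; exact: good_cst.
move=> r hr; apply: le_trans (ler_vnorm _ _) _; apply: le_trans (ler_vnormM _ _) _.
by rewrite mulrC ler_wpM2r ?mnorm_ge0 ?gc.
Qed.

Lemma duhamel_restart b A q (G Z : R -> 'M[R]_(k, q)) a t : mgood b G ->
  mprim b Z (fun t => A *m Z t + G t) -> 0 <= a -> a <= t -> t <= b ->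
  Z t = expmx A (t - a) *m Z a + vint a t (fun s => expmx A (t - s) *m G s).
Proof.
move=> gG pZ a0 at_ tb; have t0 := le_trans a0 at_; have ab := le_trans at_ tb.
have gE r : mgood b (fun s => expmx A (r - s) *m G s).
  by apply: mgoodM => //; exact: mgood_expmxB.
rewrite (duhamel_unique gG pZ (t := t)) ?t0// (duhamel_unique gG pZ (t := a)) ?a0//.
rewrite (@vint_cat _ b _ _ _ _ a)// ?a0// addrA mulmxDr; congr (_ + _ + _).
  by rewrite mulmxA -expmxD// subrK.
rewrite -(@vintMl _ b)//; apply: vint_ext => s /andP[s0 sa].
by rewrite mulmxA -expmxD ?subr_ge0// addrA subrK.
Qed.

End ExpmxIntegrals.

Section SampledError.
Context {R : realType} {n m : nat}.
Variables (Ae : 'M[R]_n) (B : 'M[R]_(n, m)) (T b bf : R).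
(** [z] stands for the prediction error, [P] for the total correction [B sig1 + Bperp sig2], and [g]
    for the uncertainty along the trajectory. *)
Variables (z P : R -> 'cV[R]_n) (g : R -> 'cV[R]_m).
Hypotheses (hAe : hurwitz Ae) (T0 : 0 < T).
Hypotheses (gP : mgood b P) (gg : mgood b g).
Hypothesis pz : mprim b z (fun t => Ae *m z t + (P t - B *m g t)).
Hypothesis z0 : z 0 = 0.
Hypothesis gbf : forall t, 0 <= t <= b -> vnorm (g t) <= bf.
Hypothesis hP : forall (q : nat) t, 0 <= t <= b -> q%:R * T <= t < q.+1%:R * T ->
  P t = - (invmx (PhiT Ae T) *m expmx Ae T *m z (q%:R * T)).
Local Notation Rint := Defs.Rint.
Local Notation E := (expmx Ae).

Let ctsE (r : R) p (C : 'M[R]_(n, p)) i j : continuous (fun s => (E (r - s) *m C) i j).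
Proof.
apply: (mulmx_continuous (Y := fun=> C)) => [l l'|]; last exact: cst_mx_continuous.
move=> s; apply: (@continuous_comp _ _ _ (fun s => r - s) (fun s => E s l l')).
  by apply: cvgB; [exact: cvg_cst|exact: cvg_id].
exact: expmx_continuous.
Qed.

Let ctsE0 p (C : 'M[R]_(n, p)) i j : continuous (fun s => (E s *m C) i j).
Proof.
apply: (mulmx_continuous (Y := fun=> C)) => [l l'|]; last exact: cst_mx_continuous.
exact: expmx_continuous.
Qed.

Let ctsN0 p (C : 'M[R]_(n, p)) : continuous (fun s => mnorm (E s *m C)).
Proof. by apply: mnorm_continuous; exact: ctsE0. Qed.

Let step (q : nat) t : 0 <= q%:R * T -> q%:R * T <= t -> t <= q.+1%:R * T -> t <= b ->
  z t = E (t - q%:R * T) *m z (q%:R * T)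
    - vint (q%:R * T) t (fun s => E (t - s) *m (invmx (PhiT Ae T) *m E T))
        *m z (q%:R * T)
    - vint (q%:R * T) t (fun s => E (t - s) *m B *m g s).
Proof.
set a := q%:R * T => a0 at_ tq tb.
have gG : mgood b (fun t => P t - B *m g t) by apply: mgoodB => //; exact: mgoodMl.
rewrite (duhamel_restart gG pz a0 at_ tb) -addrA; congr (_ + _).
have gE p (C : 'M[R]_(n, p)) : mgood b (fun s => E (t - s) *m C).
  by move=> i j; apply: good_continuous; exact: ctsE.
have gEP : mgood b (fun s => E (t - s) *m P s).
  by apply: mgoodM => //; exact: mgood_expmxB.
have gEg : mgood b (fun s => E (t - s) *m B *m g s) by exact: mgoodM.
rewrite (@vint_ext _ _ _ _ _ _ (fun s => E (t - s) *m P s + - (E (t - s) *m B *m g s)));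
  last by move=> s _; rewrite mulmxDr mulmxN mulmxA.
rewrite (@vintD _ b)//; last exact: mgoodN.
congr (_ + _); last first.
  rewrite -scaleN1r -(@vintZ _ b)//.
  by apply: vint_ext => s _; rewrite scaleN1r.
rewrite -(@vintMr _ b)// -scaleN1r -(@vintZ _ b)//; last first.
  by apply: mgoodM => //; exact: mgood_cst.
apply/matrixP => i j; rewrite !mxE.
have gQ : mgood b (fun s => -1 *: (E (t - s) *m (invmx (PhiT Ae T) *m E T) *m z a)).
  by apply: mgoodZ; apply: mgoodM => //; exact: mgood_cst.
apply: (Rint_ext_co a0 tb (gEP i j) (gQ i j)) => s /andP[as_ st].
rewrite (hP (q := q)); last 2 first.
- by rewrite (le_trans a0)//= (le_trans (ltW st)).
- by rewrite as_ (lt_le_trans st).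
by rewrite scaleN1r mulmxN !mulmxA.
Qed.

(** After a shift this is the part of [alpha0] over [[T - t, T]], and the integrand is
    nonnegative. *)
Let Bnorm_le t : 0 <= t <= T ->
  Rint 0 t (fun s => mnorm (E (t - s) *m B)) <= alpha0 Ae B T.
Proof.
move=> /andP[t0 tT]; rewrite /alpha0.
have gN : good T (fun s => mnorm (E (T - s) *m B)).
  by apply: good_continuous; apply: mnorm_continuous; exact: ctsE.
rewrite (@Rint_cat _ T 0 T _ _ (T - t))//; last by rewrite subr_ge0 tT gerBl.
have Tt : T - t <= T by rewrite gerBl.
rewrite (Rint_shift (@ctsN0 _ B) Tt).
have -> : T - (T - t) = t by ring.
by rewrite lerDr Rint_ge0// => s _; exact: mnorm_ge0.
Qed.

Let bf_ge0 t : 0 <= t <= b -> 0 <= bf.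
Proof. by move=> ht; apply: le_trans (gbf ht); exact: vnorm_ge0. Qed.

Let forcing a t : 0 <= a -> a <= t -> t <= b -> t - a <= T ->
  vnorm (vint a t (fun s => E (t - s) *m B *m g s)) <= bf * alpha0 Ae B T.
Proof.
move=> a0 at_ tb taT; have t0 := le_trans a0 at_.
apply: (@le_trans _ _ (bf * Rint a t (fun s => mnorm (E (t - s) *m B)))).
  apply: (@vnorm_vintM _ b _ _ a t bf (fun s => E (t - s) *m B) g) => //.
  by move=> r /andP[ar rt]; rewrite gbf// (le_trans a0)//= (le_trans rt).
apply: ler_wpM2l; first by apply: (@bf_ge0 t); rewrite t0.
by rewrite (Rint_shift (@ctsN0 _ B) at_) Bnorm_le// subr_ge0 at_.
Qed.

(* At the sampling instants the adaptive law cancels the propagated error. *)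
Let sample (q : nat) : q%:R * T <= b -> vnorm (z (q%:R * T)) <= bf * alpha0 Ae B T.
Proof.
have al0 : 0 <= alpha0 Ae B T by rewrite Rint_ge0// => s _; exact: mnorm_ge0.
case: q => [|q] qb.
  rewrite mul0r in qb *; rewrite z0 vnorm0 mulr_ge0//.
  by apply: (@bf_ge0 0); rewrite lexx.
have e : q.+1%:R * T = q%:R * T + T by rewrite -natr1 mulrDl mul1r.
have a0 : 0 <= q%:R * T by rewrite mulr_ge0// ltW.
have aT : q%:R * T <= q.+1%:R * T by rewrite e lerDl ltW.
rewrite (step a0 aT (lexx _) qb).
have -> : vint (q%:R * T) (q.+1%:R * T)
    (fun s => E (q.+1%:R * T - s) *m (invmx (PhiT Ae T) *m E T)) = E T.
  rewrite e (@vintMr _ (q%:R * T + T))//; last exact: mgood_expmxB.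
  rewrite vint_expmx_PhiT// ?(ltW T0) ?hurwitz_unitmx//.
  by rewrite mulmxA mulmxV ?mul1mx// PhiT_unitmx.
have -> : q.+1%:R * T - q%:R * T = T by rewrite e addrC addKr.
rewrite subrr sub0r vnormN; apply: forcing => //.
by rewrite e addrC addKr.
Qed.

(** This is where the three summands of [gamma0] arise. Since the last sample, the error is the
    propagated sampled value ([alpha1]), the effect of the held correction ([alpha2]) and the fresh
    forcing ([1]); both the sampled value and the forcing are at most [bf alpha0]. *)
Lemma sampled_error_bound t : 0 <= t <= b -> vnorm (z t) <= gamma0 bf Ae B T.
Proof.
move=> ht; have [t0 tb] := andP ht; have bf0 := bf_ge0 ht.
have al0 : 0 <= alpha0 Ae B T by rewrite Rint_ge0// => s _; exact: mnorm_ge0.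
pose q := Num.truncn (t / T).
have [qt tq] : q%:R * T <= t /\ t < q.+1%:R * T.
  have h : 0 <= t / T by rewrite divr_ge0// ltW.
  have /andP[h1 h2] := truncn_itv h.
  by split; [rewrite -ler_pdivlMr|rewrite -ltr_pdivrMr].
have a0 : 0 <= q%:R * T by rewrite mulr_ge0// ltW.
have ta : 0 <= t - q%:R * T <= T.
  rewrite subr_ge0 qt /= lerBlDr; apply: le_trans (ltW tq) _.
  by rewrite -natr1 mulrDl mul1r addrC.
have [ta0 taT] := andP ta.
have hz := sample (le_trans qt tb).
rewrite (step a0 qt (ltW tq) tb) /gamma0.
have -> : bf * alpha0 Ae B T * (alpha1 Ae T + alpha2 Ae T + 1) =
  alpha1 Ae T * (bf * alpha0 Ae B T) + alpha2 Ae T * (bf * alpha0 Ae B T)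
  + bf * alpha0 Ae B T by ring.
apply: le_trans (vnormB _ _) _; apply: lerD; last exact: forcing.
apply: le_trans (vnormB _ _) _; apply: lerD.
  apply: le_trans (ler_vnormM _ _) _; apply: ler_pM => //; rewrite ?mnorm_ge0 ?vnorm_ge0//.
  apply: ub_le_sup; last by exists (t - q%:R * T).
  have [_ [M hM]] : good T (fun s => mnorm (E s)).
    apply: good_continuous; apply: mnorm_continuous => i j; exact: expmx_continuous.
  by exists M => r [s hs ->]; apply: le_trans (hM s hs); exact: ler_norm.
set C := invmx (PhiT Ae T) *m E T.
have gC : mgood b (fun s => E (t - s) *m C).
  by move=> i j; apply: good_continuous; exact: ctsE.
rewrite -(@vintMr _ b)//.
apply: (@le_trans _ _ (bf * alpha0 Ae B T *
  Rint (q%:R * T) t (fun s => mnorm (E (t - s) *m C)))).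
  apply: (@vnorm_vintM _ b _ _ _ t _ (fun s => E (t - s) *m C) (fun=> z (q%:R * T))) => //.
  exact: mgood_cst.
rewrite mulrC; apply: ler_wpM2r; first exact: mulr_ge0.
rewrite (Rint_shift (@ctsN0 _ C) qt).
apply: ub_le_sup.
  have [_ [M hM]] : good T (fun s => mnorm (E s *m C)) by exact: good_continuous.
  exists (`|M| * T) => r [s /andP[s0 sT] ->].
  under Rint_ext do rewrite -mulmxA -/C.
  apply: le_trans (ler_norm _) _.
  apply: le_trans (@Rint_norm_le _ s 0 s (lexx _) (lexx _) `|M| _ s0 _ _) _.
  - by apply: good_continuous; apply: mnorm_continuous; exact: ctsE.
  - move=> r' /andP[r0 rs]; apply: le_trans (ler_norm M); apply: hM.
    by rewrite subr_ge0 rs (le_trans _ sT)// gerBl.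
  - by rewrite subr0 ler_wpM2l.
exists (t - q%:R * T) => //; apply: Rint_ext => s _.
by rewrite -mulmxA.
Qed.

End SampledError.

(** * Transfer-operator identities and signals *)

Section OperatorIdentities.
Context {R : realType}.

Section Hop.
Context {k a : nat}.
Variables (A : 'M[R]_k) (B : 'M[R]_(k, a)) (b : R) (u : R -> 'cV[R]_a).
Hypothesis gu : mgood b u.

Lemma HopE t : Hop A B u t = vint 0 t (fun s => expmx A (t - s) *m (B *m u s)).
Proof. by rewrite /Hop lti_state mul1mx mul0mx addr0. Qed.

Lemma Hop0 : Hop A B u 0 = 0.
Proof. by rewrite HopE vint_point. Qed.

Lemma Hop_prim : mprim b (Hop A B u) (fun t => A *m Hop A B u t + B *m u t).
Proof.
apply: mprim_ext (duhamel_prim A (mgoodMl B gu)) => t _; by rewrite HopE.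
Qed.

Lemma Hop_unique z t : mprim b z (fun t => A *m z t + B *m u t) -> z 0 = 0 ->
  0 <= t <= b -> z t = Hop A B u t.
Proof.
move=> pz z0 ht; rewrite HopE (duhamel_unique (mgoodMl B gu) pz ht).
by rewrite z0 mulmx0 add0r.
Qed.

End Hop.

(** The free response is the output of [s (s - A)^-1] for a constant input [x0], so the initial
    state can be measured by an L1 norm, as in [rho_in]. *)
Lemma sResop_expmx k (Tx A : 'M[R]_k) x0 t : 0 <= t ->
  sResop Tx A (fun=> x0) t = Tx *m (expmx A t *m x0).
Proof.
move=> t0; rewrite /sResop lti_state mul1mx.
have gx b : mgood b (fun=> x0) by exact: mgood_cst.
pose Z s := expmx A s *m x0 - x0.
have pZ : mprim t Z (fun s => A *m Z s + A *m x0).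
  apply: mprim_ext (mprimB (mprimM (mprim_expmx t A 0) (mprim_cst t x0))
    (mprim_cst t x0)) => s _; rewrite ?addr0//.
  by rewrite mulmx0 addr0 subr0 -mulmxDr subrK mulmxA.
have := duhamel_unique (mgoodMl A (gx t)) pZ (t := t).
rewrite t0 lexx => /(_ isT).
rewrite {1 2}/Z expmx0 mul1mx subrr mulmx0 add0r => e.
have -> : expmx A t *m x0 = A *m vint 0 t (fun s => expmx A (t - s) *m x0) + x0.
  rewrite -(@vintMl _ t)//; last by apply: mgoodM => //; exact: mgood_expmxB.
  rewrite -[LHS](subrK x0) e; congr (_ + _); apply: vint_ext => s _.
  by rewrite !mulmxA expmx_comm.
by rewrite mulmxDr !mulmxA.
Qed.

(** The realisation [CBAop] never differentiates [z]. Its output is shown to solve the state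
    equation of the filter driven by [w], and that equation has a unique solution. *)
Lemma Cop_prediction_error k a q (kf : 'rV[R]_a) (Bdag : 'M[R]_(a, k)) (Ae : 'M[R]_k)
    (B : 'M[R]_(k, a)) (Bp : 'M[R]_(k, q)) b w w2 z t :
  mgood b w -> mprim b z (fun t => Ae *m z t + (B *m w t + Bp *m w2 t)) -> z 0 = 0 ->
  Bdag *m B = 1%:M -> Bdag *m Bp = 0 -> 0 <= t <= b ->
  Cop kf w t = CBAop kf Bdag Ae z t.
Proof.
move=> gw pz z0 BB BBp ht; have gz := mprim_good pz.
set K := diag_mx kf; pose F := K *m Bdag + Bdag *m Ae.
have pH := Hop_prim (- K) F gz.
(* The output of the realisation, with state [Hop (- K) F z]. In its density the term
   [- K Bdag Ae z] from the state cancels against [K Bdag Ae z] from the direct feedthrough. *)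
pose W s := - K *m Hop (- K) F z s + K *m Bdag *m z s.
have -> : CBAop kf Bdag Ae z t = W t by rewrite /CBAop lti_state /W HopE.
apply/esym/(Hop_unique (b := b) (A := - K)) => //; last first.
  by rewrite /W Hop0 z0 !mulmx0 addr0.
apply: mprim_ext (mprimD (mprimMl (- K) pH) (mprimMl (K *m Bdag) pz)) => s _ //.
have -> : K *m Bdag *m (Ae *m z s + (B *m w s + Bp *m w2 s)) =
    K *m (Bdag *m Ae *m z s) + K *m w s.
  rewrite -mulmxA -mulmxDr; congr (_ *m _); rewrite !mulmxDr !mulmxA BB BBp.
  by rewrite mul1mx mul0mx addr0.
rewrite /W /F mulmxDl.
set h := - K *m Hop _ _ _ _; set a1 := K *m Bdag *m _; set c1 := Bdag *m Ae *m _.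
rewrite [h + (a1 + c1)]addrA [- K *m (h + a1 + c1)]mulmxDr -addrA; congr (_ + _).
by rewrite mulNmx addrA addNr add0r.
Qed.

(** The input bound is stated channel by channel with the gain of [C_j]. As the filter is diagonal,
    each coordinate solves its own scalar filter equation. *)
Lemma Cop_coord a (kf : 'rV[R]_a) b u t j : mgood b u -> 0 <= t <= b ->
  Cop kf u t j 0 = Cjop (kf 0 j) (fun s => (u s j 0)%:M) t 0 0.
Proof.
move=> gu ht.
have scalarE (c : R) : (c%:M : 'M[R]_1) 0 0 = c by rewrite mxE eqxx mulr1n.
have addE p q (X Y : 'M[R]_(p, q)) i i' : (X + Y) i i' = X i i' + Y i i'.
  by rewrite mxE.
have oppE p q (X : 'M[R]_(p, q)) i i' : (- X) i i' = - X i i' by rewrite mxE.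
have diagE (X : 'cV[R]_a) : (diag_mx kf *m X) j 0 = kf 0 j * X j 0.
  by rewrite mul_diag_mx mxE.
have scaleE c (X : 'M[R]_1) : (c%:M *m X) 0 0 = c * X 0 0.
  by rewrite mul_scalar_mx mxE.
pose Z s : 'cV[R]_1 := (Cop kf u s j 0)%:M.
have gj : mgood b (fun s => (u s j 0)%:M : 'cV[R]_1).
  by move=> i i'; rewrite !ord1; apply: good_ext (gu j 0) => s _; rewrite scalarE.
suff : Z t = Cjop (kf 0 j) (fun s => (u s j 0)%:M) t by move=> <-; rewrite scalarE.
apply: (Hop_unique (b := b) (A := - (kf 0 j)%:M)) => //; last first.
  have C0 : Cop kf u 0 = 0 by exact: Hop0.
  by rewrite /Z C0 [X in X%:M]mxE; apply: raddf0.
move=> i i'; rewrite !ord1.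
apply: prim_ext (Hop_prim (- diag_mx kf) (diag_mx kf) gu j 0) => s _.
  by rewrite scalarE.
by rewrite !mulNmx !addE !oppE !diagE !scaleE !scalarE.
Qed.

Lemma MP_pinv_mull k a (B : 'M[R]_(k, a)) X : is_MP_pinv B X -> \rank B = a ->
  X *m B = 1%:M.
Proof.
move=> [BXB _ _ _] rB; have /row_fullP[L LB] : row_full B by rewrite /row_full rB.
by rewrite -[LHS]mul1mx -LB -mulmxA [B *m (X *m B)]mulmxA BXB.
Qed.

(** Symmetry of [B X] gives [X = X X^T B^T], so [X] kills whatever [B^T] kills. *)
Lemma MP_pinv_orth k a q (B : 'M[R]_(k, a)) (Bp : 'M[R]_(k, q)) X :
  is_MP_pinv B X -> Bp^T *m B = 0 -> X *m Bp = 0.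
Proof.
move=> [_ XBX BXt _] e.
have eX : X = X *m (X^T *m B^T) by rewrite -trmx_mul BXt mulmxA XBX.
have BBp : B^T *m Bp = 0 by rewrite -[LHS]trmxK trmx_mul trmxK e trmx0.
by rewrite {1}eX -!mulmxA BBp !mulmx0.
Qed.

End OperatorIdentities.

(** * Measurability, continuity and bounds of the signals *)

Section Signals.
Context {R : realType}.

Lemma measurable_fun_cat (a c : R) (u : R -> R) : 0 <= a -> a <= c ->
  measurable_fun `[0, a] u -> measurable_fun `[a, c] u -> measurable_fun `[0, c] u.
Proof.
move=> a0 ac m1 m2.
have : measurable_fun (`[0, a] `|` `[a, c]) u by apply/measurable_funU.
apply: measurable_funS; first exact: measurableU.
move=> t /=; rewrite !in_itv/= => /andP[t0 tc].
by have [ta|/ltW ta] := leP t a; [left; rewrite t0|right; rewrite ta tc].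
Qed.

Lemma bounded_sig_good k (v : R -> 'cV[R]_k) (b : R) :
  bounded_sig v -> (forall i, measurable_fun (`[0, b] : set R) (fun t => v t i 0)) ->
  mgood b v.
Proof.
move=> [M hM] mv i j; rewrite ord1; split=> //; exists M => t /andP[t0 _].
by apply: le_trans (hM t t0); exact: ler_vnorm.
Qed.

Lemma pw_continuous_good k (v : R -> 'cV[R]_k) b :
  pw_continuous v -> bounded_sig v -> 0 <= b -> mgood b v.
Proof.
(* Partitions are provided only for intervals of positive length; enlarging [b] by one covers
   [b = 0]. *)
move=> pv bv b0; apply: (mgoodW (b := b + 1)); first by rewrite lerDl.
apply: bounded_sig_good => // i.
have b1 : 0 < b + 1 by rewrite ltr_wpDl.
have [N [tau [t0 tN tS hg]]] := pv _ b1.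
suff H q : (q <= N)%N -> 0 <= tau q /\ measurable_fun `[0, tau q] (fun t => v t i 0).
  by rewrite -tN; apply: (H N _).2.
elim: q => [_|q IH qN].
  by rewrite t0 set_itv1; split=> //; exact: measurable_fun_set1.
have [tq0 mq] := IH (ltnW qN); have tqS := ltW (tS q qN).
split; first exact: le_trans tqS.
apply: (measurable_fun_cat tq0 tqS mq).
apply: (@measurable_fun_itv_cc _ _ _ false true).
have [g [cg eg]] := hg q qN.
apply: (@eq_measurable_fun _ _ _ _ _ (fun t => g t i 0)).
  by move=> t; rewrite inE/= in_itv/= => ht; rewrite eg.
apply: (measurable_funS (E := `[tau q, tau q.+1])) => //.
  exact: subset_itv_oo_cc.
by apply: subspace_continuous_measurable_fun => //; exact: cg.
Qed.

Lemma sampled_good (T b : R) (u : R -> R) (c : nat -> R) : 0 < T ->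
  (forall q t, q%:R * T <= t < q.+1%:R * T -> u t = c q) -> good b u.
Proof.
move=> T0 hc; pose N := (Num.truncn (b / T)).+1.
have bN : b < N%:R * T by rewrite -ltr_pdivrMr// truncnS_gt.
apply: (goodW (b := N%:R * T)); first exact: ltW.
split.
  elim: N {bN} => [|N IH]; first by rewrite mul0r set_itv1; exact: measurable_fun_set1.
  apply: (@measurable_fun_cat (N%:R * T)) => //.
  - by rewrite mulr_ge0// ltW.
  - by rewrite ler_wpM2r ?ler_nat// ltW.
  - apply: (@measurable_fun_itv_cc _ _ _ true true).
    apply: (@eq_measurable_fun _ _ _ _ _ (fun=> c N)) => //.
    by move=> t; rewrite inE/= in_itv/= => ht; rewrite (hc N).
exists (\sum_(q < N.+1) `|c q|) => t /andP[t0 tN].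
pose q := Num.truncn (t / T).
have h : 0 <= t / T by rewrite divr_ge0// ltW.
have /andP[h1 h2] := truncn_itv h.
have qN : (q < N.+1)%N.
  rewrite ltnS -(ler_nat R); apply: le_trans h1 _.
  by rewrite ler_pdivrMr.
rewrite (hc q); last by rewrite -ler_pdivlMr// -ltr_pdivrMr// h1 h2.
by rewrite (bigD1 (Ordinal qN))//= lerDl sumr_ge0.
Qed.

Lemma cont_sig_within k (x : R -> 'cV[R]_k) b i : cont_sig x ->
  {within `[0, b], continuous (fun t => x t i 0)}.
Proof.
move=> /(_ i); apply: continuous_subspaceW => t /=; rewrite !in_itv/=.
by case/andP=> ->.
Qed.

Lemma f_consts_within k m (f : R -> 'cV[R]_k -> 'cV[R]_m) (Z : set 'cV[R]_k) j L l c
    (y : R -> 'cV[R]_k) b :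
  f_consts f Z j L l c ->
  (forall i, {within `[0, b], continuous (fun t => y t i 0)}) ->
  (forall t, 0 <= t <= b -> Z (y t)) ->
  {within `[0, b], continuous (fun t => f t (y t) j 0)}.
Proof.
move=> hf cy Zy; apply/subspace_continuousP => s /=; rewrite in_itv/= => hs.
(* [f_consts] puts no sign on [L] and [l], hence the absolute values; the sum over coordinates
   replaces the max norm so that the limit can be taken termwise. *)
pose D t := `|L| * \sum_i `|y s i 0 - y t i 0| + `|l| * `|s - t|.
have cD : D t @[t --> within `[0, b] (nbhs s)] --> (0 : R).
  have h i : `|y s i 0 - y t i 0| @[t --> within `[0, b] (nbhs s)] --> (0 : R).
    have : `|y s i 0 - y t i 0| @[t --> within `[0, b] (nbhs s)] -->
        `|y s i 0 - y s i 0|.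
      apply: cvg_norm; apply: cvgB; first exact: cvg_cst.
      have /subspace_continuousP/(_ s) h := cy i; apply: h.
      by rewrite /= in_itv.
    by rewrite subrr normr0.
  have hs' : `|s - t| @[t --> within `[0, b] (nbhs s)] --> (0 : R).
    have : `|s - t| @[t --> within `[0, b] (nbhs s)] --> `|s - s|.
      apply: cvg_norm; apply: cvgB; first exact: cvg_cst.
      exact: cvg_within.
    by rewrite subrr normr0.
  have : D t @[t --> within `[0, b] (nbhs s)] -->
      `|L| * (\sum_(i < k) 0) + `|l| * 0.
    apply: cvgD; apply: cvgMr => //.
    by apply: cvg_big => [|i _]; [exact: add_continuous|exact: h].
  by rewrite big1// !mulr0 addr0.
apply/(@cvgrPdist_le _ R^o) => e e0; near=> t.
have ht : 0 <= t <= b.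
  have : `[0, b]%classic t by near: t; exact: withinT.
  by rewrite /= in_itv.
apply: (@le_trans _ _ (D t)); last first.
  apply: le_trans (ler_norm _) _; near: t; exact: cvgr0_norm_le.
have [s0 _] := andP hs; have [t0 _] := andP ht.
have [+ _] := hf s t (y s) (y t) s0 t0 (Zy _ hs) (Zy _ ht).
move=> /le_trans; apply; apply: lerD; last by rewrite ler_wpM2r// ler_norm.
apply: (@le_trans _ _ (`|L| * vnorm (y s - y t))).
  by rewrite ler_wpM2r ?vnorm_ge0 ?ler_norm.
rewrite ler_wpM2l//; apply: vnorm_le => [|i]; first by rewrite sumr_ge0.
by rewrite (bigD1 i)//= !mxE lerDl sumr_ge0.
Unshelve. all: end_near. Qed.

Lemma compact_vnorm_le_sup k (X : set 'cV[R]_k) x : compact X -> X x ->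
  vnorm x <= sup [set r | exists2 z, X z & r = vnorm z].
Proof.
move=> cX Xx; apply: ub_le_sup; last by exists x.
have /compact_bounded[M [_ hM]] := cX.
exists (`|M| + 1) => r [z Xz ->].
have hz : `|z| <= `|M| + 1.
  by apply: hM => //; rewrite (le_lt_trans (ler_norm M))// ltrDl.
apply: vnorm_le => [|i]; first by rewrite addr_ge0.
apply: le_trans hz; rewrite -[leRHS]/(mx_norm z) mx_normrE.
exact: (le_bigmax 0 (fun ij => `|z ij.1 ij.2|) (i, 0)).
Qed.

End Signals.

(** * The adaptive loop *)

Section Continuation.
Context {R : realType}.

Lemma within_continuous_dist (b : R) (phi : R -> R) s e :
  {within `[0, b], continuous phi} -> 0 <= s <= b -> 0 < e ->
  exists2 d, 0 < d & forall r, 0 <= r <= b -> `|r - s| < d -> `|phi r - phi s| < e.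
Proof.
move=> /subspace_continuousP/(_ s) + hs e0; rewrite /= in_itv/= => /(_ hs).
move=> /(@cvgrPdist_lt _ R^o)/(_ e e0); rewrite near_withinE => /nbhs_ballP[d d0 hd].
exists d => // r hr rs; rewrite distrC; apply: hd; rewrite /= ?in_itv//.
by rewrite /ball/= distrC.
Qed.

(** Let [c] be the supremum of the times up to which the bound holds. Continuity gives the bound at
    [c]; [step] makes it strict there, and continuity carries it past [c], a contradiction if
    [c < t]. *)
Lemma continuous_induction (phi : R -> R) (rho : R) :
  (forall b, {within `[0, b], continuous phi}) -> phi 0 <= rho ->
  (forall b, 0 <= b -> (forall t, 0 <= t <= b -> phi t <= rho) -> phi b < rho) ->
  forall t, 0 <= t -> phi t <= rho.
Proof.
move=> cphi phi0 step t t0; rewrite leNgt; apply/negP => ht.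
pose S := [set s | 0 <= s <= t /\ forall r, 0 <= r <= s -> phi r <= rho].
have S0 : S 0.
  split; first by rewrite lexx.
  by move=> r; rewrite -eq_le => /eqP <-.
have ubS : has_ubound S by exists t => s [/andP[]].
have supS : has_sup S by split; [exists 0|].
pose c := sup S.
have c0 : 0 <= c by exact: (ub_le_sup ubS).
have ct : c <= t by apply: ge_sup; [exists 0|move=> s [/andP[]]].
have before r : 0 <= r -> r < c -> phi r <= rho.
  move=> r0 rc; have cr : 0 < c - r by rewrite subr_gt0.
  have [s [_ Ss] rs] := sup_adherent cr supS.
  by apply: Ss; rewrite r0 ltW//; move: rs; rewrite -/c; lra.
have hc : 0 <= c <= t by rewrite c0.
have phic : phi c <= rho.
  rewrite leNgt; apply/negP => hphi.
  have e0 : 0 < phi c - rho by rewrite subr_gt0.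
  have [d d0 hd] := within_continuous_dist (cphi t) hc e0.
  have cpos : 0 < c.
    by rewrite lt_neqAle c0 andbT; apply: contraTneq hphi => <-; rewrite -leNgt.
  pose r := c - Num.min c d / 2.
  have m0 : 0 < Num.min c d by rewrite lt_min cpos.
  have mc : Num.min c d <= c by rewrite ge_min lexx.
  have md : Num.min c d <= d by rewrite ge_min lexx orbT.
  have r0 : 0 <= r by rewrite /r; lra.
  have rc : r < c by rewrite /r; lra.
  have := before r r0 rc; have := hd r.
  rewrite r0 (ltW (lt_le_trans rc ct)) => /(_ isT).
  have -> : `|r - c| = Num.min c d / 2.
    have -> : r - c = - (Num.min c d / 2) by rewrite /r; ring.
    by rewrite normrN gtr0_norm// divr_gt0.
  have md2 : Num.min c d / 2 < d by lra.
  move=> /(_ md2); rewrite ltr_norml => /andP[h _]; lra.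
have hS : forall r, 0 <= r <= c -> phi r <= rho.
  move=> r /andP[r0]; rewrite le_eqVlt => /predU1P[->//|rc]; exact: before.
have phic' := step c c0 hS.
have ct' : c < t.
  by rewrite lt_neqAle ct andbT; apply: contraTneq ht => <-; rewrite -leNgt.
have e0 : 0 < rho - phi c by rewrite subr_gt0.
have [d d0 hd] := within_continuous_dist (cphi t) hc e0.
pose s := c + Num.min (t - c) d / 2.
have tc0 : 0 < t - c by rewrite subr_gt0.
have m0 : 0 < Num.min (t - c) d by rewrite lt_min tc0.
have mc : Num.min (t - c) d <= t - c by rewrite ge_min lexx.
have md : Num.min (t - c) d <= d by rewrite ge_min lexx orbT.
have : S s.
  split; first by rewrite /s; apply/andP; split; lra.
  move=> r /andP[r0 rs]; have [rc|cr] := leP r c; first by apply: hS; rewrite r0.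
  have := hd r; rewrite r0 /= (_ : r <= t); last by move: rs; rewrite /s; lra.
  rewrite gtr0_norm ?subr_gt0// => /(_ isT).
  have rd : r - c < d by move: rs; rewrite /s; lra.
  move=> /(_ rd); rewrite ltr_norml => /andP[_ h]; lra.
move=> /(ub_le_sup ubS); rewrite -/c /s; lra.
Qed.

(** The iterates converge geometrically to the fixed point [E / (1 - q)]. Two consecutive indices
    are provided because the input estimate uses [y_N] and the state estimate
    [y_(N+1) = xn + G f(.,y_N)]. *)
Lemma affine_iter_lt (q E D0 g : R) : 0 <= q < 1 -> E / (1 - q) < g ->
  exists k, iter k (fun d => q * d + E) D0 < g /\
            iter k.+1 (fun d => q * d + E) D0 < g.
Proof.
move=> /andP[q0 q1] hg; pose L := E / (1 - q).
have q1' : 1 - q != 0 by rewrite subr_eq0 gt_eqF.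
have e k : iter k (fun d => q * d + E) D0 = (D0 - L) * q ^+ k + L.
  elim: k => [|k IH]; first by rewrite expr0 mulr1 subrK.
  by rewrite iterS IH exprS /L; field.
have cv : (D0 - L) * q ^+ k + L @[k --> \oo] --> L.
  rewrite -[X in _ --> X]add0r -[X in _ --> X + _](mulr0 (D0 - L)).
  apply: cvgD; last exact: cvg_cst.
  by apply: cvgMr; apply: cvg_expr; rewrite ger0_norm.
have [N _ hN] := cvgr_lt L cv g hg.
by exists N; rewrite !e; split; apply: hN => /=.
Qed.

Lemma vnorm_within_continuous k (x : R -> 'cV[R]_k) b :
  (forall i, {within `[0, b], continuous (fun t => x t i 0)}) ->
  {within `[0, b], continuous (fun t => vnorm (x t))}.
Proof.
move=> cx.
(* The norm is viewed as a time-independent uncertainty with Lipschitz constant 1, so that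
   [f_consts_within] applies. *)
pose f (t : R) (z : 'cV[R]_k) : 'cV[R]_1 := (vnorm z)%:M.
have fE t z : f t z 0 0 = vnorm z by rewrite mxE eqxx mulr1n.
have bi i : exists M, forall t, 0 <= t <= b -> `|x t i 0| <= M.
  by have [_] := good_within_continuous (cx i).
have [M hM] := choice bi.
have hb t : 0 <= t <= b -> vnorm (x t) <= \sum_i `|M i|.
  move=> ht; apply: vnorm_le => [|i]; first by rewrite sumr_ge0.
  apply: le_trans (hM i t ht) _; apply: le_trans (ler_norm _) _.
  by rewrite (bigD1 i)//= lerDl sumr_ge0.
have fc : f_consts f (Omega (\sum_i `|M i|)) 0 1 0 (\sum_i `|M i|).
  move=> s t y z _ _ yM zM; rewrite !fE mul1r mul0r addr0; split; last first.
    by rewrite ger0_norm ?vnorm_ge0.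
  rewrite ler_norml; apply/andP; split.
    rewrite lerNl opprB lerBlDl -[z in leLHS](subKr y) -(vnormN (y - z)) opprB.
    exact: vnormD.
  by rewrite lerBlDr -[y in leLHS](subrK z); exact: vnormD.
have := f_consts_within fc cx hb.
by rewrite (_ : (fun t => f t (x t) 0 0) = (fun t => vnorm (x t)))//; apply/funext.
Qed.

End Continuation.

Fixpoint picard {R : realType} {k a : nat} (x0 : R -> 'cV[R]_k)
    (G : (R -> 'cV[R]_a) -> R -> 'cV[R]_k) (f : R -> 'cV[R]_k -> 'cV[R]_a)
    (N : nat) : R -> 'cV[R]_k :=
  if N is N'.+1 then fun t => x0 t + G (fun s => f s (picard x0 G f N' s)) t
  else x0.

(** * Comparison of the closed loop with the Picard iterates *)

Section AdaptiveLoop.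
Context {R : realType} {m p : nat}.
Variables (Am Ae : 'M[R]_(m + p)) (B : 'M[R]_(m + p, m)) (Bv : 'M[R]_(m + p, m)).
Variables (Bperp : 'M[R]_(m + p, p)) (Bdag : 'M[R]_(m, m + p)) (kf : 'rV[R]_m).
Variables (v : R -> 'cV[R]_m) (x0 : 'cV[R]_(m + p)) (maxX0 T rho_r gamma1 : R).
Variable f : R -> 'cV[R]_(m + p) -> 'cV[R]_m.
Variables (b_rr L_rho b_rho b_Xr : 'I_m -> R).
Variables (Tx : 'I_(m + p) -> 'M[R]_(m + p)) (rho_chk : 'I_(m + p) -> R).
Variables (xn x xh : R -> 'cV[R]_(m + p)) (ua sig1 : R -> 'cV[R]_m).
Variable sig2 : R -> 'cV[R]_p.

Let rho := rho_r + gamma1.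
Let Xr := [set z : 'cV[R]_(m + p) | forall i, `|z i 0| <= rho_chk i].
Let g0 := gamma0 (maxc b_rho) Ae B T.
Let G := Gop Am B kf.
Let q := l1norm G * maxc L_rho.

Hypotheses (rankB : \rank B = m) (hAm : hurwitz Am) (hAe : hurwitz Ae).
Hypotheses (pv : pw_continuous v) (bv : bounded_sig v).
Hypothesis x0max : vnorm x0 <= maxX0.
Hypothesis kf0 : forall j, 0 < kf 0 j.
Hypotheses (BpB : Bperp^T *m B = 0) (rankBB : \rank (row_mx B Bperp) = (m + p)%N).
Hypotheses (MP : is_MP_pinv B Bdag) (T0 : 0 < T).
Hypothesis f_rr : forall j, exists L l, f_consts f (Omega rho_r) j L l (b_rr j).
Hypothesis f_rho : forall j, exists l, f_consts f (Omega rho) j (L_rho j) l (b_rho j).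
Hypothesis f_Xr : forall j, exists L l, f_consts f Xr j L l (b_Xr j).
Hypothesis gamma10 : 0 < gamma1.
Hypothesis C1 : l1norm G * maxc b_rr
  < rho_r - l1norm (Hop Am Bv) * supnorm v - l1norm (sResop 1%:M Am) * maxX0.
Hypothesis C2 : q < 1.
Hypothesis C3 :
  l1norm (compop (Hop Am B) (CBAop kf Bdag Ae)) / (1 - q) * g0 < gamma1.
Hypothesis hTx : forall i, exists d : 'rV[R]_(m + p),
  [/\ Tx i = diag_mx d, d 0 i = 1 & forall k, 0 < d 0 k <= 1].
Hypothesis hchk : forall i, l1norm (premul (Tx i) G) * maxc b_rr
  < rho_chk i - l1norm (premul (Tx i) (Hop Am Bv)) * supnorm v
    - l1norm (sResop (Tx i) Am) * maxX0.
Hypothesis cxn : cont_sig xn.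
Hypothesis exn : forall t, 0 <= t ->
  xn t = x0 + vint 0 t (fun s => Am *m xn s + Bv *m v s).
Hypotheses (cx : cont_sig x) (cxh : cont_sig xh).
Hypothesis ex : forall t, 0 <= t ->
  x t = x0 + vint 0 t (fun s => Am *m x s + Bv *m v s + B *m (ua s + f s (x s))).
Hypothesis exh : forall t, 0 <= t ->
  xh t = x0 + vint 0 t (fun s => Am *m x s + Bv *m v s
    + B *m (ua s + sig1 s) + Bperp *m sig2 s + Ae *m (xh s - x s)).
Hypothesis hsig : forall (q : nat) t, q%:R * T <= t < q.+1%:R * T ->
  col_mx (sig1 t) (sig2 t) =
    - (invmx (row_mx B Bperp) *m invmx (PhiT Ae T) *m expmx Ae T
       *m (xh (q%:R * T) - x (q%:R * T))).
Hypothesis hua : forall t, 0 <= t -> ua t = - Cop kf sig1 t.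

Let sH a (C : 'M[R]_(m + p, a)) : stable_op (Hop Am C). Proof. exact: stable_lti. Qed.
Let sC : stable_op (Cop kf). Proof. exact/stable_lti/hurwitz_Ndiag. Qed.
Let sG : stable_op G. Proof. exact: stable_comp (sH B) (stable_idB sC). Qed.
Let sTG i : stable_op (premul (Tx i) G). Proof. exact: stable_premul. Qed.
Let sCBA : stable_op (CBAop kf Bdag Ae). Proof. exact/stable_lti/hurwitz_Ndiag. Qed.
Let sHCBA : stable_op (compop (Hop Am B) (CBAop kf Bdag Ae)).
Proof. exact: stable_comp. Qed.

Let vnorm_maxc k (z : 'cV[R]_k) c : (forall j, `|z j 0| <= c j) -> vnorm z <= maxc c.
Proof.
move=> h; apply: vnorm_le => [|j]; first exact: maxc_ge0.
exact: le_trans (h j) (ler_maxc _ _).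
Qed.

(** The unit weight at position [i] keeps that coordinate intact in the scaled norm. *)
Let Tx_coord i (z : 'cV[R]_(m + p)) : `|z i 0| <= vnorm (Tx i *m z).
Proof.
have [d [-> di _]] := hTx i; apply: le_trans (ler_vnorm _ i).
by rewrite mul_diag_mx mxE di mul1r.
Qed.

Let v_good b : 0 <= b -> mgood b v.
Proof. exact: pw_continuous_good. Qed.

Let v_le t : 0 <= t -> vnorm (v t) <= supnorm v.
Proof. by have [M hM] := bv; exact: ler_supnorm hM. Qed.

Let cont_good (y : R -> 'cV[R]_(m + p)) b : cont_sig y -> mgood b y.
Proof.
by move=> cy i j; rewrite ord1; apply: good_within_continuous; exact: cont_sig_within.
Qed.

Let xn_prim b : 0 <= b -> mprim b xn (fun t => Am *m xn t + Bv *m v t).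
Proof.
move=> b0; apply: (mprim_vint (C := x0)) => [|t /andP[t0 _]]; last exact: exn.
by apply: mgoodD; apply: mgoodMl; [exact: cont_good|exact: v_good].
Qed.

Let xn0 : xn 0 = x0. Proof. by rewrite exn// vint_point addr0. Qed.
Let x_0 : x 0 = x0. Proof. by rewrite ex// vint_point addr0. Qed.

Let xnE t : 0 <= t -> xn t = expmx Am t *m x0 + Hop Am Bv v t.
Proof.
move=> t0; rewrite HopE -{1}xn0.
apply: (duhamel_unique (b := t)); [|exact: xn_prim|by rewrite t0 lexx].
by apply: mgoodMl; exact: v_good.
Qed.

Let free_response (C : 'M[R]_(m + p)) t : 0 <= t ->
  vnorm (C *m (expmx Am t *m x0)) <= l1norm (sResop C Am) * maxX0.
Proof.
move=> t0; rewrite -sResop_expmx//.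
have sR : stable_op (sResop C Am) by exact: stable_lti.
apply: (l1norm_bound sR (b := t)) => //; last by rewrite t0 lexx.
exact: mgood_cst.
Qed.

Let xn_bound t : 0 <= t ->
  vnorm (xn t) <= l1norm (Hop Am Bv) * supnorm v + l1norm (sResop 1%:M Am) * maxX0.
Proof.
move=> t0; rewrite xnE// addrC; apply: le_trans (vnormD _ _) _; apply: lerD.
  apply: (l1norm_bound (sH _) (b := t)); rewrite ?t0 ?lexx//; first exact: v_good.
  by move=> s /andP[s0 _]; exact: v_le.
by rewrite -[X in vnorm X]mul1mx free_response.
Qed.

Let xn_coord i t : 0 <= t -> `|xn t i 0| <=
  l1norm (premul (Tx i) (Hop Am Bv)) * supnorm v + l1norm (sResop (Tx i) Am) * maxX0.
Proof.
move=> t0; apply: le_trans (Tx_coord i _) _; rewrite xnE// mulmxDr addrC.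
apply: le_trans (vnormD _ _) _; apply: lerD; last exact: free_response.
apply: (l1norm_bound (stable_premul (Tx i) (sH Bv)) (b := t)); rewrite ?t0 ?lexx//.
  exact: v_good.
by move=> s /andP[s0 _]; exact: v_le.
Qed.

Local Notation y := (picard xn G f).

Let f_good (z : R -> 'cV[R]_(m + p)) b :
  (forall i, {within `[0, b], continuous (fun t => z t i 0)}) ->
  (forall t, 0 <= t <= b -> vnorm (z t) <= rho) -> mgood b (fun s => f s (z s)).
Proof.
move=> cz hz j i; rewrite ord1; have [l hl] := f_rho j.
by apply: good_within_continuous; exact: f_consts_within hl cz hz.
Qed.

Let rho_r_le : rho_r <= rho. Proof. by rewrite lerDl ltW. Qed.

Let G_within b u i : mgood b u -> {within `[0, b], continuous (fun t => G u t i 0)}.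
Proof.
move=> gu; apply: prim_continuous (Hop_prim Am B _ i 0).
by apply: mgoodB => //; exact: stable_good sC _ _ gu.
Qed.

(** The bound [rho_r] sustains itself: in [Omega rho_r] the uncertainty is at most [b_rr], and (C1)
    brings the next iterate back. Membership in [Xr] follows from the same bound [b_rr] through the
    scaled conditions. Continuity is carried along to make [f(.,y_N)] an admissible input. *)
Let picard_props b N : 0 <= b ->
  [/\ forall i, {within `[0, b], continuous (fun t => y N t i 0)},
      forall t, 0 <= t <= b -> vnorm (y N t) <= rho_r
    & forall t, 0 <= t <= b -> Xr (y N t)].
Proof.
move=> b0; elim: N => [|N [cN rN XN]].
  split=> [i|t /andP[t0 _]|t /andP[t0 _] i] /=; first exact: cont_sig_within.
    apply: le_trans (xn_bound t0) _.
    by have := mulr_ge0 (l1norm_ge0 sG) (maxc_ge0 b_rr); move: C1; lra.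
  apply: le_trans (xn_coord i t0) _.
  by have := mulr_ge0 (l1norm_ge0 (sTG i)) (maxc_ge0 b_rr); move: (hchk i); lra.
have gf : mgood b (fun s => f s (y N s)).
  by apply: f_good => // t ht; apply: le_trans (rN t ht) _.
have fb s : 0 <= s <= b -> vnorm (f s (y N s)) <= maxc b_rr.
  move=> hs; apply: vnorm_maxc => j; have [L [l hf]] := f_rr j.
  have [s0 _] := andP hs.
  by have [] := hf s s _ _ s0 s0 (rN s hs) (rN s hs).
split=> [i|t ht|t ht i] /=.
- have := within_continuousD (@cont_sig_within _ _ xn b i cxn) (@G_within b _ i gf).
  rewrite (_ : _ + _ = fun t => (xn t + G (fun s => f s (y N s)) t) i 0)//.
  by apply/funext => t; rewrite [RHS]mxE.
- have [t0 _] := andP ht; apply: le_trans (vnormD _ _) _.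
  apply: le_trans (lerD (xn_bound t0) (l1norm_bound sG gf fb ht)) _.
  by move: C1; lra.
- have [t0 _] := andP ht; rewrite mxE; apply: le_trans (ler_normD _ _) _.
  have hG := le_trans (Tx_coord i _) (l1norm_bound (sTG i) gf fb ht).
  apply: le_trans (lerD (xn_coord i t0) hG) _.
  by move: (hchk i); lra.
Qed.

Section OnInterval.
Variable b : R.
Hypotheses (b0 : 0 <= b) (xb : forall t, 0 <= t <= b -> vnorm (x t) <= rho).

(** [F] is the uncertainty met by the actual state, [w] the error of its estimate, [z] the
    prediction error. *)
Let F s := f s (x s).
Let w s := sig1 s - F s.
Let z s := xh s - x s.

Let gF : mgood b F.
Proof. by apply: f_good => // i; exact: cont_sig_within. Qed.

Let sig_good : mgood b sig1 /\ mgood b sig2.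
Proof.
pose S (q : nat) := - (invmx (row_mx B Bperp) *m invmx (PhiT Ae T) *m expmx Ae T
       *m (xh (q%:R * T) - x (q%:R * T))).
split=> i j; rewrite ord1.
- apply: (@sampled_good _ T b _ (fun q => S q (lshift p i) 0)) => // k t ht.
  by rewrite -(col_mxEu (sig1 t) (sig2 t)) (hsig ht).
- apply: (@sampled_good _ T b _ (fun q => S q (rshift m i) 0)) => // k t ht.
  by rewrite -(col_mxEd (sig1 t) (sig2 t)) (hsig ht).
Qed.

Let gsig1 := sig_good.1.
Let gsig2 := sig_good.2.

Let gw : mgood b w. Proof. exact: mgoodB. Qed.

Let gua : mgood b ua.
Proof.
apply: mgood_ext (mgoodN (stable_good sC gsig1)) => t /andP[t0 _].
by rewrite hua.
Qed.

Let gx : mgood b x. Proof. exact: cont_good. Qed.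
Let gxh : mgood b xh. Proof. exact: cont_good. Qed.

Let x_prim : mprim b x (fun t => Am *m x t + Bv *m v t + B *m (ua t + F t)).
Proof.
apply: (mprim_vint (C := x0)) => [|t /andP[t0 _]]; last exact: ex.
apply: mgoodD; last by apply: mgoodMl; exact: mgoodD.
by apply: mgoodD; apply: mgoodMl => //; exact: v_good.
Qed.

(** The predictor feeds the measured state into [Am], so all terms in [Am x], [Bv v] and [B ua]
    cancel and only [Ae] governs the error. *)
Let z_prim0 : mprim b z (fun t => Ae *m z t + (B *m w t + Bperp *m sig2 t)).
Proof.
have pxh : mprim b xh (fun s => Am *m x s + Bv *m v s
    + B *m (ua s + sig1 s) + Bperp *m sig2 s + Ae *m (xh s - x s)).
  apply: (mprim_vint (C := x0)) => [|t /andP[t0 _]]; last exact: exh.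
  apply: mgoodD; last by apply: mgoodMl; exact: mgoodB.
  apply: mgoodD; last exact: mgoodMl.
  apply: mgoodD; last by apply: mgoodMl; exact: mgoodD.
  by apply: mgoodD; apply: mgoodMl => //; exact: v_good.
apply: mprim_ext (mprimB pxh x_prim) => t _ //.
rewrite /w /z !mulmxDr !mulmxN.
move: (Am *m x t) (Bv *m v t) (B *m ua t) (B *m sig1 t) (B *m F t)
  (Bperp *m sig2 t) (Ae *m xh t) (Ae *m x t) => a1 a2 a3 a4 a5 a6 a7 a8.
by apply/matrixP => i j; rewrite !mxE; ring.
Qed.

Let z0 : z 0 = 0.
Proof. by rewrite /z x_0 exh// vint_point addr0 subrr. Qed.

Let z_bound t : 0 <= t <= b -> vnorm (z t) <= g0.
Proof.
pose P t := B *m sig1 t + Bperp *m sig2 t.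
have gP : mgood b P by apply: mgoodD; exact: mgoodMl.
apply: (@sampled_error_bound R (m + p) m Ae B T b (maxc b_rho) z P F) => //.
- apply: mprim_ext z_prim0 => s _ //; congr (_ + _).
  by rewrite /w /P mulmxDr mulmxN addrAC.
- move=> s hs; apply: vnorm_maxc => j; have [l hf] := f_rho j.
  have [s0 _] := andP hs.
  by have [] := hf s s _ _ s0 s0 (xb hs) (xb hs).
(* Recombining [B sig1 + Bperp sig2] cancels the inverse of [[B Bperp]] in the adaptive law. *)
- move=> k s hs hk; rewrite /P -mul_row_col (hsig hk) mulmxN !mulmxA mulmxV ?mul1mx//.
  by rewrite -row_free_unit /row_free rankBB.
Qed.

Let Cw t : 0 <= t <= b -> Cop kf w t = CBAop kf Bdag Ae z t.
Proof.
move=> ht; apply: (Cop_prediction_error (b := b) kf gw z_prim0 z0) => //.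
- exact: MP_pinv_mull.
- exact: MP_pinv_orth BpB.
Qed.

Let CsigE t : 0 <= t <= b -> Cop kf sig1 t = Cop kf F t + Cop kf w t.
Proof.
move=> ht; rewrite -(stableD sC gF gw ht); apply: (stable_ext sC (b := b)) => //.
by move=> s _; rewrite /w subrKC.
Qed.

(** [x - xn] is the response to [ua + F], and [ua = - C sig1 = - C F - C w] turns this input into
    [(1 - C) F - C w]. *)
Let xE t : 0 <= t <= b ->
  x t = xn t + G F t - compop (Hop Am B) (CBAop kf Bdag Ae) z t.
Proof.
move=> ht; have gCF := stable_good sC gF; have gCw := stable_good sC gw.
have gFC : mgood b (fun s => F s - Cop kf F s) by exact: mgoodB.
have guF : mgood b (fun s => ua s + F s) by exact: mgoodD.
have e : x t - xn t = Hop Am B (fun s => ua s + F s) t.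
  apply: (@Hop_unique _ _ _ Am B b _ guF (fun s => x s - xn s)) => //; last first.
    by rewrite x_0 xn0 subrr.
  apply: mprim_ext (mprimB x_prim (xn_prim b0)) => s _ //.
  by rewrite mulmxBr addrAC opprD addrA [X in X + _]addrAC addrK.
rewrite -[LHS](subrKC (xn t)) e -addrA; congr (_ + _).
rewrite /compop.
have -> : Hop Am B (CBAop kf Bdag Ae z) t = Hop Am B (Cop kf w) t.
  by apply/esym/(stable_ext (sH B) (b := b)) => // s hs; exact: Cw.
rewrite /G /Gop -(stableB (sH B) gFC gCw ht).
apply: (stable_ext (sH B) (b := b)) => // s hs; have [s0 _] := andP hs.
by rewrite hua// CsigE// opprD addrC addrA.
Qed.

Let Eb := l1norm (compop (Hop Am B) (CBAop kf Bdag Ae)) * g0.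

Let gz : mgood b z. Proof. exact: mgoodB. Qed.

Let gfy N : mgood b (fun s => f s (y N s)).
Proof.
have [cN rN _] := picard_props N b0.
by apply: f_good => // t ht; apply: le_trans (rN t ht) _.
Qed.

Let fdiff N D t : 0 <= t <= b -> vnorm (x t - y N t) <= D ->
  vnorm (F t - f t (y N t)) <= maxc L_rho * D.
Proof.
move=> ht hD; have [_ rN _] := picard_props N b0; have [t0 _] := andP ht.
have D0 : 0 <= D by apply: le_trans hD; exact: vnorm_ge0.
apply: vnorm_le => [|j]; first by rewrite mulr_ge0 ?maxc_ge0.
have [l hf] := f_rho j.
have [+ _] := hf t t (x t) (y N t) t0 t0 (xb ht) (le_trans (rN t ht) rho_r_le).
rewrite subrr normr0 mulr0 addr0 !mxE => /le_trans; apply.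
apply: (@le_trans _ _ (maxc L_rho * vnorm (x t - y N t))).
  by rewrite ler_wpM2r ?vnorm_ge0 ?ler_maxc.
by rewrite ler_wpM2l ?maxc_ge0.
Qed.

(** The starting value is the crude distance between a point of [Omega rho] and one of
    [Omega rho_r]. *)
Let D N := iter N (fun d => q * d + Eb) (rho + rho_r).

Lemma picard_error N t : 0 <= t <= b -> vnorm (x t - y N t) <= D N.
Proof.
elim: N t => [|N IH] t ht.
  have [_ r0 _] := picard_props 0 b0.
  by apply: le_trans (vnormB _ _) _; apply: lerD; [exact: xb|exact: (r0 t ht)].
have gd : mgood b (fun s => F s - f s (y N s)) by exact: mgoodB.
have -> : x t - y N.+1 t =
    G (fun s => F s - f s (y N s)) t - compop (Hop Am B) (CBAop kf Bdag Ae) z t.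
  rewrite (stableB sG gF (gfy N) ht) xE//=.
  move: (G F t) (G _ t) (compop _ _ _ _) (xn t) => a1 a2 a3 a4.
  by apply/matrixP => i j; rewrite !mxE; ring.
rewrite /D iterS; apply: le_trans (vnormB _ _) _; apply: lerD.
  rewrite /q -mulrA; apply: (l1norm_bound sG gd _ ht) => s hs.
  by apply: fdiff => //; exact: IH.
rewrite /Eb; apply: (l1norm_bound sHCBA gz _ ht) => s hs; exact: z_bound.
Qed.

Lemma picard_close : exists N, D N < gamma1 /\ D N.+1 < gamma1.
Proof.
apply: affine_iter_lt.
  by rewrite C2 andbT mulr_ge0 ?maxc_ge0// l1norm_ge0.
by rewrite /Eb mulrAC.
Qed.

Lemma x_lt_rho : vnorm (x b) < rho.
Proof.
have [N [hN _]] := picard_close; have [_ rN _] := picard_props N b0.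
have hb : 0 <= b <= b by rewrite b0 lexx.
have -> : x b = x b - y N b + y N b by rewrite subrK.
rewrite /rho [rho_r + _]addrC; apply: le_lt_trans (vnormD _ _) _.
by apply: ltr_leD; [exact: le_lt_trans (picard_error N hb) hN|exact: rN].
Qed.

Let fy_Xr N j s : 0 <= s <= b -> `|f s (y N s) j 0| <= b_Xr j.
Proof.
move=> hs; have [_ _ XN] := picard_props N b0; have [s0 _] := andP hs.
have [L [l hf]] := f_Xr j.
by have [] := hf s s _ _ s0 s0 (XN s hs) (XN s hs).
Qed.

(** Writing [x - xn = G f(.,y_N) + (x - y_(N+1))] evaluates [f] only on an iterate. This is why
    [b_Xr] suffices although [x] itself is not shown to lie in [Xr]. *)
Lemma state_deviation i :
  `|x b i 0 - xn b i 0| <= l1norm (premul (Tx i) G) * maxc b_Xr + gamma1.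
Proof.
have hb : 0 <= b <= b by rewrite b0 lexx.
have [N [_ hN]] := picard_close.
have -> : x b i 0 - xn b i 0 = G (fun s => f s (y N s)) b i 0 + (x b - y N.+1 b) i 0.
  rewrite /=; move: (G _ b) => a1; rewrite !mxE; ring.
apply: le_trans (ler_normD _ _) _; apply: lerD.
  apply: le_trans (Tx_coord i _) _.
  apply: (l1norm_bound (sTG i) (gfy N) _ hb) => s hs.
  by apply: vnorm_maxc => j; exact: fy_Xr.
by apply: le_trans (ler_vnorm _ i) _; apply: le_trans (picard_error N.+1 hb) _; exact: ltW.
Qed.

(** The input is minus the sum of three parts: the filtered [f(.,y_N)], bounded per channel by
    [b_Xr j]; the filtered difference [f(.,x) - f(.,y_N)], bounded by the Lipschitz constant times
    [gamma1]; and the prediction error term. The last two make up [gamma2]. *)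
Lemma adaptive_input_bound j : `|ua b j 0| <= l1norm (Cjop (kf 0 j)) * b_Xr j
  + (l1norm (Cop kf) * maxc L_rho * gamma1 + l1norm (CBAop kf Bdag Ae) * g0).
Proof.
have hb : 0 <= b <= b by rewrite b0 lexx.
have [N [hN _]] := picard_close.
have gd : mgood b (fun s => F s - f s (y N s)) by exact: mgoodB.
have e : Cop kf F b = Cop kf (fun s => f s (y N s)) b
    + Cop kf (fun s => F s - f s (y N s)) b.
  by rewrite (stableB sC gF (gfy N) hb) subrKC.
rewrite hua// CsigE// e Cw// -addrA.
move: (Cop_coord kf j (gfy N) hb).
set a1 := Cop kf _ b; set a2 := Cop kf _ b; set a3 := CBAop _ _ _ _ _ => e1.
have -> : (- (a1 + (a2 + a3))) j 0 = - (a1 j 0 + (a2 j 0 + a3 j 0)).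
  by move: a1 a2 a3 {e1} => a1 a2 a3; rewrite !mxE.
rewrite normrN; apply: le_trans (ler_normD _ _) _; apply: lerD.
  rewrite e1; apply: le_trans (ler_vnorm _ 0) _.
  have sCj : stable_op (Cjop (kf 0 j)).
    by apply: stable_lti; apply: hurwitz_Nscalar.
  have scalarE (c : R) : (c%:M : 'M[R]_1) 0 0 = c by rewrite mxE eqxx mulr1n.
  apply: (l1norm_bound sCj (b := b)) => //.
    by move=> i i'; rewrite !ord1; apply: good_ext (gfy N j 0) => s _; rewrite scalarE.
  move=> s hs; apply: vnorm_le => [|i].
    exact: le_trans (normr_ge0 _) (fy_Xr N j hs).
  by rewrite ord1 scalarE; exact: fy_Xr.
apply: le_trans (ler_normD _ _) _; apply: lerD.
  apply: le_trans (ler_vnorm _ j) _; rewrite -mulrA.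
  apply: (l1norm_bound sC gd _ hb) => s hs; apply: fdiff => //.
  by apply: le_trans (picard_error N hs) _; exact: ltW.
apply: le_trans (ler_vnorm _ j) _.
apply: (l1norm_bound sCBA gz _ hb) => s hs; exact: z_bound.
Qed.

End OnInterval.

Lemma x_in_Omega t : 0 <= t -> vnorm (x t) <= rho.
Proof.
move: t; apply: (@continuous_induction _ (fun t => vnorm (x t))).
- by move=> b; apply: vnorm_within_continuous => i; exact: cont_sig_within.
- rewrite x_0 -xn0; have [_ r0 _] := picard_props 0 (lexx 0).
  by apply: le_trans (r0 0 _) rho_r_le; rewrite lexx.
- exact: x_lt_rho.
Qed.

Lemma adaptive_loop_bounds t : 0 <= t ->
  (forall i, `|x t i 0 - xn t i 0| <= l1norm (premul (Tx i) G) * maxc b_Xr + gamma1) /\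
  (forall j, `|ua t j 0| <= l1norm (Cjop (kf 0 j)) * b_Xr j
    + (l1norm (Cop kf) * maxc L_rho * gamma1 + l1norm (CBAop kf Bdag Ae) * g0)).
Proof.
move=> t0; have hx s : 0 <= s <= t -> vnorm (x s) <= rho.
  by move=> /andP[s0 _]; exact: x_in_Omega.
by split=> [i|j]; [exact: state_deviation|exact: adaptive_input_bound].
Qed.

End AdaptiveLoop.

(* n = m + p states (m <= n since B has full column rank), m inputs *)
Theorem theorem3 (R : realType) (m p : nat)
  (A : 'M[R]_(m + p)) (B : 'M[R]_(m + p, m))
  (Kx : 'M[R]_(m, m + p)) (Kv : 'M[R]_m)
  (v : R -> 'cV[R]_m) (X0 : set 'cV[R]_(m + p)) (x0 : 'cV[R]_(m + p))
  (f : R -> 'cV[R]_(m + p) -> 'cV[R]_m)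
  (kf : 'rV[R]_m) (Ae : 'M[R]_(m + p)) (Bperp : 'M[R]_(m + p, p))
  (Bdag : 'M[R]_(m, m + p)) (T : R)
  (rho_r gamma1 : R) (b_rr L_rho b_rho b_Xr : 'I_m -> R)
  (Tx : 'I_(m + p) -> 'M[R]_(m + p)) (rho_chk : 'I_(m + p) -> R)
  (xn x xh : R -> 'cV[R]_(m + p)) (ua sig1 : R -> 'cV[R]_m)
  (sig2 : R -> 'cV[R]_p) :
  let Am := A + B *m Kx in
  let Bv := B *m Kv in
  let rho := rho_r + gamma1 in
  let maxX0 := sup [set r | exists2 z, X0 z & r = vnorm z] in
  let rho_in := l1norm (sResop 1%:M Am) * maxX0 in
  let Xr := [set z : 'cV[R]_(m + p) | forall i, `|z i 0| <= rho_chk i] in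
  let g0 := gamma0 (maxc b_rho) Ae B T in
  (* standing setup *)
  \rank B = m ->
  hurwitz Am ->
  pw_continuous v -> bounded_sig v ->
  compact X0 -> X0 x0 ->
  f_standing f ->
  (forall j, 0 < kf 0 j) ->
  hurwitz Ae ->
  Bperp^T *m B = 0 -> \rank (row_mx B Bperp) = (m + p)%N ->
  is_MP_pinv B Bdag ->
  0 < T ->
  (* constants of f on Omega(rho_r), Omega(rho), X_r *)
  (forall j, exists L l, f_consts f (Omega rho_r) j L l (b_rr j)) ->
  (forall j, exists l, f_consts f (Omega rho) j (L_rho j) l (b_rho j)) ->
  (forall j, exists L l, f_consts f Xr j L l (b_Xr j)) ->
  (* (C1), (C2), (C3) *)
  0 < rho_r -> 0 < gamma1 ->
  l1norm (Gop Am B kf) * maxc b_rr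
    < rho_r - l1norm (Hop Am Bv) * supnorm v - rho_in ->
  l1norm (Gop Am B kf) * maxc L_rho < 1 ->
  l1norm (compop (Hop Am B) (CBAop kf Bdag Ae))
    / (1 - l1norm (Gop Am B kf) * maxc L_rho) * g0 < gamma1 ->
  (* scaling matrices *)
  (forall i, exists d : 'rV[R]_(m + p),
     [/\ Tx i = diag_mx d, d 0 i = 1 & forall k, 0 < d 0 k <= 1]) ->
  (forall i, 0 < rho_chk i) ->
  (forall i, l1norm (premul (Tx i) (Gop Am B kf)) * maxc b_rr
     < rho_chk i - l1norm (premul (Tx i) (Hop Am Bv)) * supnorm v
       - l1norm (sResop (Tx i) Am) * maxX0) ->
  (* nominal system *)
  cont_sig xn ->
  (forall t, 0 <= t ->
     xn t = x0 + vint 0 t (fun s => Am *m xn s + Bv *m v s)) ->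
  (* closed-loop adaptive system *)
  cont_sig x -> cont_sig xh ->
  (forall t, 0 <= t ->
     x t = x0 + vint 0 t (fun s => Am *m x s + Bv *m v s
                                  + B *m (ua s + f s (x s)))) ->
  (forall t, 0 <= t ->
     xh t = x0 + vint 0 t (fun s => Am *m x s + Bv *m v s
                                   + B *m (ua s + sig1 s) + Bperp *m sig2 s
                                   + Ae *m (xh s - x s))) ->
  (forall (q : nat) t, q%:R * T <= t < q.+1%:R * T ->
     col_mx (sig1 t) (sig2 t) =
       - (invmx (row_mx B Bperp) *m invmx (PhiT Ae T) *m expmx Ae T
          *m (xh (q%:R * T) - x (q%:R * T)))) ->
  (forall t, 0 <= t -> ua t = - Cop kf sig1 t) ->
  let gamma2 := l1norm (Cop kf) * maxc L_rho * gamma1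
                + l1norm (CBAop kf Bdag Ae) * g0 in
  let rho_t := fun i => l1norm (premul (Tx i) (Gop Am B kf)) * maxc b_Xr
                        + gamma1 in
  let rho_ua := fun j => l1norm (Cjop (kf 0 j)) * b_Xr j + gamma2 in
  let rho_u := fun j => rho_ua j + \sum_(i < m + p) `|Kx j i| * rho_t i in
  let u := fun t => Kx *m x t + Kv *m v t + ua t in
  let un := fun t => Kx *m xn t + Kv *m v t in
  forall t, 0 <= t ->
    [/\ forall i, `|x t i 0 - xn t i 0| <= rho_t i,
        forall j, `|ua t j 0| <= rho_ua j
      & forall j, `|u t j 0 - un t j 0| <= rho_u j].
Proof.
move=> Am Bv rho maxX0 rho_in Xr g0 rankB hAm pv bv cX0 X0x0 _ kf0 hAe BpB rankBB MP T0.
move=> f_rr f_rho f_Xr _ g10 C1 C2 C3 hTx _ hchk cxn exn cx cxh ex exh hsig hua.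
move=> gamma2 rho_t rho_ua rho_u u un t t0.
have x0max : vnorm x0 <= maxX0 by exact: compact_vnorm_le_sup.
have [hx hu] := adaptive_loop_bounds rankB hAm hAe pv bv x0max kf0 BpB rankBB MP T0
  f_rr f_rho f_Xr g10 C1 C2 C3 hTx hchk cxn exn cx cxh ex exh hsig hua t0.
split=> // j; rewrite /rho_u [leRHS]addrC.
(* The feedforward [Kv v] is common to both inputs and cancels. *)
have -> : u t j 0 - un t j 0 = \sum_i Kx j i * (x t i 0 - xn t i 0) + ua t j 0.
  transitivity ((Kx *m (x t - xn t)) j 0 + ua t j 0); last first.
    by rewrite mxE; congr (_ + _); apply: eq_bigr => i _; rewrite !mxE.
  rewrite /u /un mulmxBr; move: (Kx *m x t) (Kx *m xn t) (Kv *m v t) => a1 a2 a3.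
  by rewrite !mxE; ring.
apply: le_trans (ler_normD _ _) _; apply: lerD; last exact: hu.
apply: le_trans (ler_norm_sum _ _ _) _; apply: ler_sum => i _.
by rewrite normrM ler_wpM2l// hx.
Qed.
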